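(* Let $\eta>1$, $\epsilon>0$, $\zeta>1$, and let $\mu$ be a distribution over $\{-1,+1\}^n$ such that (1) $(\boldsymbol\lambda*\mu)$ is $\eta$-spectrally independent for all $\boldsymbol\lambda\in(0,1+\epsilon]^n$, and (2) $(\boldsymbol\lambda*\mu)$ is $\zeta$-marginally stable for all $\boldsymbol\lambda\in(0,1]^n$. Then for every $\theta\in(0,1)$, $$\rho^{\mathrm{GD}}(\mu)\ge\left(\frac{\theta}{\mathrm e}\right)^{30\eta+\frac{\log(4\zeta)}{\log(1+\epsilon)}}\rho^{\mathrm{GD}}_{\min}(\theta*\mu).$$
   Context: For a distribution $\mu$ on $\{-1,+1\}^n$: $\Omega(\mu)$ is its support; for $\Lambda\subseteq[n]$, $\mu_\Lambda$ is the marginal on $\Lambda$, $\mu_i=\mu_{\{i\}}$; for $\sigma\in\Omega(\mu_\Lambda)$, $\mu^\sigma$ is $\mu$ conditioned on agreeing with $\sigma$ on $\Lambda$ (a distribution on $\{-1,+1\}^n$), and $\mu^{\sigma\wedge i\gets x}$ is $\mu^\sigma$ further conditioned on coordinate $i$ being $x\in\Omega(\mu^\sigma_i)$. For $\boldsymbol\lambda\in\mathbb R^n_{>0}$, $(\boldsymbol\lambda*\mu)(\sigma)\propto\mu(\sigma)\prod_{i:\sigma_i=+1}\lambda_i$; for a scalar $\theta>0$, $\theta*\mu$ means all $\lambda_i=\theta$. $\eta$-spectral independence: for all $\Lambda\subseteq[n]$ and $\sigma\in\Omega(\mu_\Lambda)$, the spectral radius of the matrix $\Psi_{\mu^\sigma}(i,j)=\max_{x,y\in\Omega(\mu^\sigma_i)}d_{\mathrm{TV}}(\mu_j^{\sigma\wedge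 i\gets x},\mu_j^{\sigma\wedge i\gets y})$ ($i,j\in[n]$) is at most $\eta$. $\zeta$-marginal stability: for every $i\in[n]$, every $S\subseteq\Lambda\subseteq[n]\setminus\{i\}$ and every $\sigma\in\Omega(\mu_\Lambda)$, $R_i^\sigma\le\zeta$ and $R_i^\sigma\le\zeta R_i^{\sigma_S}$, where $R_i^\sigma=\mu_i^\sigma(+1)/\mu_i^\sigma(-1)$. Glauber dynamics on $\mu$: from $\sigma\in\Omega(\mu)$, pick $i\in[n]$ uniformly and resample $\sigma_i$ from $\mu_i^{\sigma_{[n]\setminus\{i\}}}$; with transition matrix $P$, $\rho^{\mathrm{GD}}(\mu)=\inf\{\langle f,(I-P)\log f\rangle_\mu/\mathrm{Ent}_\mu(f): f:\Omega(\mu)\to\mathbb R_{\ge0},\mathrm{Ent}_\mu(f)\neq0\}$, with $\langle f,g\rangle_\mu=\sum_\sigma\mu(\sigma)f(\sigma)g(\sigma)$, $\mathrm{Ent}_\mu(f)=\mathbb E_\mu[f\log f]-\mathbb E_\mu[f]\log\mathbb E_\mu[f]$, $0\log0=0$. Also $\rho^{\mathrm{GD}}_{\min}(\mu)=\min_{\Lambda\subseteq[n]}\min_{\sigma\in\Omega(\mu_\Lambda)}\rho^{\mathrm{GD}}(\mu^\sigma)$. *)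

(* Defs.v *)
From HB Require Import structures.
From mathcomp Require Import all_boot all_order all_algebra.
From mathcomp Require Import all_classical all_reals all_analysis.
From mathcomp Require Import complex.

Set Implicit Arguments.
Unset Strict Implicit.
Unset Printing Implicit Defensive.

Import Order.TTheory GRing.Theory Num.Theory.
Local Open Scope ring_scope.

Section Defs.
Variables (R : realType) (n : nat).

(* a configuration in {-1,+1}^n; true encodes +1, false encodes -1 *)
Definition cfg := {ffun 'I_n -> bool}.

Definition is_distr (mu : cfg -> R) : Prop :=
  (forall s, 0 <= mu s) /\ \sum_(s : cfg) mu s = 1.

Definition in_support (mu : cfg -> R) (s : cfg) : bool := 0 < mu s.

Definition agree (L : {set 'I_n}) (s t : cfg) : bool :=
  [forall i in L, s i == t i].

Definition in_support_marg (mu : cfg -> R) (L : {set 'I_n}) (s : cfg) : Prop :=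
  exists t, in_support mu t /\ agree L s t.

Definition cond (mu : cfg -> R) (L : {set 'I_n}) (s : cfg) : cfg -> R :=
  fun t => if agree L s t
           then mu t / (\sum_(u : cfg | agree L s u) mu u) else 0.

Definition marg1 (mu : cfg -> R) (i : 'I_n) (x : bool) : R :=
  \sum_(t : cfg | t i == x) mu t.

Definition upd (s : cfg) (i : 'I_n) (x : bool) : cfg :=
  [ffun j => if j == i then x else s j].

Definition dTV (p q : bool -> R) : R :=
  (\sum_(b : bool) `|p b - q b|) / 2.

Definition influence (mu : cfg -> R) (L : {set 'I_n}) (s : cfg) : 'M[R]_n :=
  \matrix_(i < n, j < n)
    \big[Num.max/0]_(x : bool | 0 < marg1 (cond mu L s) i x)
      \big[Num.max/0]_(y : bool | 0 < marg1 (cond mu L s) i y)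
         dTV (marg1 (cond mu (i |: L) (upd s i x)) j)
             (marg1 (cond mu (i |: L) (upd s i y)) j).

(* spectral radius: the largest modulus of a complex eigenvalue
   (0 for the empty matrix) *)
Definition spectral_radius (A : 'M[R]_n) : R :=
  sup [set Normc.normc z | z in
        [set z : R[i] | eigenvalue (map_mx (fun x : R => (x%:C)%C) A) z]].

Definition spectrally_independent (eta : R) (mu : cfg -> R) : Prop :=
  forall (L : {set 'I_n}) (s : cfg), in_support_marg mu L s ->
    spectral_radius (influence mu L s) <= eta.

Definition tilt (lam : 'I_n -> R) (mu : cfg -> R) : cfg -> R :=
  fun s => mu s * (\prod_(i | s i) lam i) /
           (\sum_(t : cfg) mu t * \prod_(i | t i) lam i).

Definition ratio (mu : cfg -> R) (L : {set 'I_n}) (s : cfg) (i : 'I_n)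
  : \bar R :=
  if marg1 (cond mu L s) i false == 0 then +oo%E
  else (marg1 (cond mu L s) i true / marg1 (cond mu L s) i false)%:E.

Definition marginally_stable (zeta : R) (mu : cfg -> R) : Prop :=
  forall (i : 'I_n) (S L : {set 'I_n}) (s : cfg),
    S \subset L -> i \notin L -> in_support_marg mu L s ->
    (ratio mu L s i <= zeta%:E)%E /\
    (ratio mu L s i <= zeta%:E * ratio mu S s i)%E.

Definition glauber (mu : cfg -> R) (s t : cfg) : R :=
  (n%:R)^-1 * \sum_(i < n)
     (if agree (~: [set i]) s t
      then marg1 (cond mu (~: [set i]) s) i (t i) else 0).

Definition lnE (x : R) : \bar R := if x == 0 then -oo%E else (ln x)%:E.

(* <f, (I - P) log f>_mu, with the convention 0 * (-oo) = 0 *)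
Definition dirichlet (mu : cfg -> R) (f : cfg -> R) : \bar R :=
  (\sum_(s : cfg) (mu s * f s)%:E * lnE (f s)
   - \sum_(s : cfg) \sum_(t : cfg) (mu s * f s * glauber mu s t)%:E * lnE (f t))%E.

(* Ent_mu(f), with 0 log 0 = 0 *)
Definition Ent (mu : cfg -> R) (f : cfg -> R) : R :=
  \sum_(s : cfg) mu s * (f s * ln (f s))
  - (\sum_(s : cfg) mu s * f s) * ln (\sum_(s : cfg) mu s * f s).

(* rho^GD(mu) : infimum over f : Omega(mu) -> R_{>=0} with Ent_mu(f) <> 0
   (values of f outside Omega(mu) play no role) *)
Definition rhoGD (mu : cfg -> R) : \bar R :=
  ereal_inf [set (dirichlet mu f / (Ent mu f)%:E)%E | f in
             [set f : cfg -> R | (forall s, 0 <= f s) /\ Ent mu f != 0]].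

Definition rhoGD_min (mu : cfg -> R) : \bar R :=
  ereal_inf [set rhoGD (cond mu Ls.1 Ls.2) | Ls in
             [set Ls : {set 'I_n} * cfg | in_support_marg mu Ls.1 Ls.2]].

End Defs.

(* Main.v *)
Require Import Defs.
From HB Require Import structures.
From mathcomp Require Import all_boot all_order all_algebra.
From mathcomp Require Import all_classical all_reals all_analysis.
From mathcomp Require Import complex spectral ring lra.
Import Order.TTheory GRing.Theory Num.Theory.
Local Open Scope ring_scope.

Set Implicit Arguments.
Unset Strict Implicit.
Unset Printing Implicit Defensive.

(* Negative-fields localization.  Starting from [mu], pin every [+1]
   coordinate independently with probability [1 - th] and let [E th] be the mean
   entropy of [f] under the resulting conditional measures, which are the pinned
   versions of [th * mu].  Then [E 1 = Ent mu f], and [E' th] is a mean of the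
   infinitesimal losses [sum_i (nu_i ln (nu_i / pi_i) - nu_i + pi_i) / th] with
   [pi] the current measure, [nu = f pi / pi f] and [nu_i], [pi_i] the
   probabilities of [+1] at [i].  Entropic independence bounds the loss
   by [kappa Ent_pi f / th], whence [E th >= th^kappa Ent mu f].

   By duality entropic independence is the bound
   [E_pi prod_i z_i^(x_i / kappa) <= exp (sum_i pi_i (z_i - 1) / kappa)] for all
   [z > 0], with [x_i] the indicator of [+1] at [i].  On
   [z <= (1 + eps)^kappa] its logarithm is concave in [z], because
   spectral independence of the tilted measures gives
   [Cov <= kappa diag (mean)].  Beyond that range each coordinate is raised
   separately: marginal stability makes raising [z_i^(1/kappa)] by [d] cost at
   most a factor [exp (zeta pi_i d)], and [kappa] is large enough for
   [zeta (1 + eps) <= (1 + eps)^kappa].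

   Finally the Glauber Dirichlet form is concave in the measure, its edge
   weights being [x y / (x + y)], so it does not increase along the
   localization. *)

(** * Spectral radius and quadratic forms *)

Section SpectralBound.
Variable R : realType.
Implicit Type n : nat.

(** A supremum bounds its members only when the set is bounded above; the sum of the moduli of all
    roots of the characteristic polynomial is such a bound. *)
Lemma eigenvalue_le_spectral_radius n (A : 'M[R]_n) (z : R[i]) :
  eigenvalue (map_mx (fun x : R => (x%:C)%C) A) z ->
  Normc.normc z <= spectral_radius A.
Proof.
move=> ez; apply: ub_le_sup; last by exists z.
set M := map_mx _ A.
have [rs rsE] := closed_field_poly_normal (char_poly M).
exists (\sum_(w <- rs) Normc.normc w) => _ [w /= ew <-].
have wrs : w \in rs.
  have := ew; rewrite eigenvalue_root_char rsE rootZ ?root_prod_XsubC//.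
  by rewrite lead_coef_eq0 -size_poly_eq0 size_char_poly.
have normc_ge0 (u : R[i]) : 0 <= Normc.normc u.
  by case: u => a b; rewrite /Normc.normc sqrtr_ge0.
by rewrite (big_rem w)//= lerDl sumr_ge0.
Qed.

Local Notation cR := (real_complex R).
Local Open Scope sesquilinear_scope.

(** In a unitary eigenbasis over [R[i]] the form is the sum of [d_j |y_j|^2]. The eigenvalues [d_j]
    are real, so a bound on their moduli bounds them from above. *)
Lemma symmetric_rayleigh_le n (S : 'M[R]_n) (r : R) :
  S^T = S ->
  (forall z : R[i], eigenvalue (map_mx (fun x : R => (x%:C)%C) S) z ->
     Normc.normc z <= r) ->
  forall x : 'rV[R]_n, (x *m S *m x^T) 0 0 <= r * (x *m x^T) 0 0.
Proof.
move=> Ssym Hr x.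
pose A : 'M[R[i]]_n := map_mx cR S.
have cRreal (a : R) : cR a \is Num.real by apply/complex_realP; exists a.
have Areal : A \is a mxOver Num.real.
  by apply/mxOverP => i j; rewrite mxE; exact: cRreal.
have Asym : A \is symmetricmx.
  by apply/is_hermitianmxP; rewrite expr0 scale1r map_mx_id// /A map_trmx Ssym.
have Aherm := realsym_hermsym Asym Areal.
have AE : A = invmx (spectralmx A) *m diag_mx (spectral_diag A) *m spectralmx A.
  exact/orthomx_spectralP/hermitian_normalmx.
have spR := hermitian_spectral_diag_real Aherm.
have Pu := spectral_unitarymx A.
move: (spectralmx A) (spectral_diag A) AE spR Pu => P d AE dR Pu.
have Pun := unitarymx_unit Pu.
have eigd j : eigenvalue A (d 0 j).
  apply/eigenvalueP; exists (row j P).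
    rewrite {1}AE -row_mul !mulmxA mulmxV// mul1mx.
    by rewrite row_mul row_diag_mx -scalemxAl -rowE.
  apply/eqP => Pj0; move: Pun; rewrite -row_free_unit.
  move/row_freeP => [B PB]; have := congr1 (fun M => row j M 0 j) PB.
  by rewrite row_mul Pj0 mul0mx !mxE eqxx => /eqP; rewrite eq_sym oner_eq0.
have dle j : d 0 j <= cR r.
  have /= := Hr _ (eigd j).
  have /mxOverP/(_ 0 j)/complex_realP[k ->] := dR.
  rewrite /Normc.normc /= expr0n addr0 sqrtr_sqr => kr.
  by rewrite lecR (le_trans (ler_norm _)).
pose X : 'rV[R[i]]_n := map_mx cR x.
have Xc : X^t* = map_mx cR x^T.
  by apply/matrixP => i j; rewrite !mxE; apply/CrealP.
pose Y := X *m P^t*.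
have YcE : Y^t* = P *m X^t*.
  by rewrite /Y trmx_mul map_mxM trmxCK.
have YYc : Y *m Y^t* = X *m X^t*.
  rewrite YcE /Y mulmxA -(invmx_unitary Pu) -[X *m _ *m _]mulmxA.
  by rewrite mulVmx// mulmx1.
have XAX : X *m A *m X^t* = Y *m diag_mx d *m Y^t*.
  by rewrite YcE AE (invmx_unitary Pu) /Y !mulmxA.
have -> : ((x *m S *m x^T) 0 0 <= r * (x *m x^T) 0 0) =
    (cR ((x *m S *m x^T) 0 0) <= cR (r * (x *m x^T) 0 0)) by rewrite lecR.
have -> : cR (r * (x *m x^T) 0 0) = cR r * (Y *m Y^t*) 0 0.
  by rewrite rmorphM YYc Xc -map_mxM [in RHS]mxE.
have -> : cR ((x *m S *m x^T) 0 0) = (Y *m diag_mx d *m Y^t*) 0 0.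
  by rewrite -XAX Xc -!map_mxM [RHS]mxE.
rewrite mul_mx_diag !mxE mulr_sumr ler_sum// => j _; rewrite !mxE.
rewrite mulrAC mulrC ler_wpM2r//.
by rewrite -normCK exprn_ge0.
Qed.

End SpectralBound.

(** * Influence matrix and covariances *)

Section Conditioning.
Variables (R : realType) (n : nat).
Implicit Types (mu : cfg n -> R) (L : {set 'I_n}) (s t : cfg n).

Lemma agree_setU1_upd L s t i x :
  i \notin L -> agree (i |: L) (upd s i x) t = agree L s t && (t i == x).
Proof.
move=> iL; apply/forall_inP/andP => [H|[/forall_inP H /eqP tix] j].
  split; last by have := H i (setU11 _ _); rewrite ffunE eqxx eq_sym.
  apply/forall_inP => j jL; have := H j (setU1r _ jL).
  by rewrite ffunE; have [ji|//] := eqVneq j i; move: iL; rewrite -ji jL.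
rewrite in_setU1 ffunE => /orP[/eqP ->|jL]; first by rewrite eqxx tix.
have [->|_] := eqVneq j i; [by rewrite tix | exact: H].
Qed.

Lemma agree_weight_gt0 mu L s : (forall t, 0 <= mu t) ->
  in_support_marg mu L s -> 0 < \sum_(u | agree L s u) mu u.
Proof.
move=> mu0 [t [t0 st]]; rewrite (bigD1 t)//=.
by rewrite ltr_wpDr// sumr_ge0.
Qed.

Lemma cond_ge0 mu L s t : (forall t, 0 <= mu t) -> 0 <= cond mu L s t.
Proof.
by move=> mu0; rewrite /cond; case: ifP => // _; rewrite divr_ge0 ?sumr_ge0.
Qed.

Lemma cond_sum1 mu L s : (forall t, 0 <= mu t) ->
  in_support_marg mu L s -> \sum_t cond mu L s t = 1.
Proof.
move=> mu0 sup; rewrite /cond -big_mkcond -mulr_suml divff//.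
by rewrite gt_eqF// agree_weight_gt0.
Qed.

Lemma marg1_ge0 mu i x : (forall t, 0 <= mu t) -> 0 <= marg1 mu i x.
Proof. by move=> mu0; rewrite sumr_ge0. Qed.

Lemma marg1_true mu i : marg1 mu i true = \sum_t mu t * (t i)%:R.
Proof.
rewrite /marg1 big_mkcond; apply: eq_bigr => t _.
by case: (t i); rewrite ?mulr1 ?mulr0.
Qed.

Lemma marg1_sum mu i : marg1 mu i true + marg1 mu i false = \sum_t mu t.
Proof.
rewrite [RHS](bigID (fun t : cfg n => t i))/=; congr (_ + _); apply: eq_bigl => t.
  by rewrite eqb_id.
by rewrite eqbF_neg.
Qed.

(** Conditioning in two stages. Since division by zero gives zero, a value [x] of conditional
    probability zero is covered too. *)
Lemma marg1_cond_setU1 mu L s i j x : (forall t, 0 <= mu t) ->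
  in_support_marg mu L s -> i \notin L ->
  marg1 (cond mu (i |: L) (upd s i x)) j true =
  (\sum_(t : cfg n | t i == x) cond mu L s t * (t j)%:R) / marg1 (cond mu L s) i x.
Proof.
move=> mu0 sup iL; set m := cond mu L s.
have Z0 := agree_weight_gt0 mu0 sup; set Z := (\sum_(u | _) _) in Z0.
have mE (t : cfg n) : m t = (agree L s t)%:R * mu t / Z.
  by rewrite /m /cond; case: ifP; rewrite ?mul1r ?mul0r.
have -> : marg1 m i x = (\sum_(u | agree (i |: L) (upd s i x) u) mu u) / Z.
  rewrite /marg1 mulr_suml big_mkcond [RHS]big_mkcond; apply: eq_bigr => t _.
  rewrite agree_setU1_upd// mE andbC.
  by case: (t i == x) => //=; case: ifP; rewrite ?mul1r ?mul0r.
rewrite invf_div mulrA marg1_true !mulr_suml.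
rewrite [RHS]big_mkcond; apply: eq_bigr => t _.
rewrite /cond agree_setU1_upd// mE andbC.
case: (t i == x) => //=; last by rewrite mul0r.
case: ifP => _; last by rewrite !mul0r.
by rewrite mul1r [mu t / Z * _]mulrAC divfK ?gt_eqF// mulrAC.
Qed.

Lemma dTV_bernoulli (p q : bool -> R) :
  p true + p false = q true + q false -> dTV p q = `|p true - q true|.
Proof.
rewrite /dTV big_bool /= => pq.
have -> : p false - q false = - (p true - q true) by lra.
by rewrite normrN mulrDl -splitr.
Qed.

End Conditioning.

(** * Variance of linear statistics from the spectral radius of the influence matrix *)

Section InfluenceVariance.
Variables (R : realType) (n : nat) (mu : cfg n -> R).
Variables (L : {set 'I_n}) (s : cfg n).
Hypothesis mu_ge0 : forall t, 0 <= mu t.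
Hypothesis feas : in_support_marg mu L s.

Let m := cond mu L s.
Let p (i : 'I_n) := \sum_t m t * (t i)%:R.
Let cov (i j : 'I_n) := \sum_t m t * ((t i)%:R * (t j)%:R) - p i * p j.
Let d (i : 'I_n) := p i * (1 - p i).

Let m_ge0 t : 0 <= m t. Proof. exact: cond_ge0. Qed.
Let m_sum : \sum_t m t = 1. Proof. exact: cond_sum1. Qed.
Let margT i : marg1 m i true = p i. Proof. exact: marg1_true. Qed.
Let margF i : marg1 m i false = 1 - p i.
Proof. by have := marg1_sum m i; rewrite m_sum margT => <-; lra. Qed.
Let p_ge0 i : 0 <= p i. Proof. by rewrite -margT marg1_ge0. Qed.
Let p_le1 i : p i <= 1.
Proof. by have := marg1_ge0 i false m_ge0; rewrite margF subr_ge0. Qed.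
Let d_ge0 i : 0 <= d i. Proof. by rewrite mulr_ge0// subr_ge0. Qed.

Let covC i j : cov i j = cov j i.
Proof.
rewrite /cov [p i * _]mulrC; congr (_ - _).
by apply: eq_bigr => t _; rewrite [_%:R * _]mulrC.
Qed.

(** With zero variance, coordinate [i] is almost surely constant. *)
Let cov_d0 i j : d i = 0 -> cov i j = 0.
Proof.
move/eqP; rewrite mulf_eq0 subr_eq0 => /orP[] /eqP pi.
  have m0 (t : cfg n) : t i -> m t = 0.
    move=> ti; have := pi; rewrite -margT => /(psumr_eq0P (fun u _ => m_ge0 u)).
    by move=> /(_ t); rewrite ti; exact.
  rewrite /cov pi mul0r subr0 big1// => t _.
  by case: (boolP (t i)) => [/m0 ->|]; rewrite !mul0r ?mulr0.
have m0 (t : cfg n) : t i = false -> m t = 0.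
  move=> ti; have : marg1 m i false = 0 by rewrite margF -pi subrr.
  by move=> /(psumr_eq0P (fun u _ => m_ge0 u))/(_ t); rewrite ti; exact.
rewrite /cov -pi mul1r; apply/eqP; rewrite subr_eq0; apply/eqP.
apply: eq_bigr => t _; case: (boolP (t i)) => [_|/negbTE/m0 ->].
  by rewrite mul1r.
by rewrite !mul0r.
Qed.

Let infl := influence mu L s.

(** The conditional means of coordinate [j] given [+1] and [-1] at [i] differ by [cov i j / d i],
    and on two points total variation is the difference of means. *)
Let influenceE i j : d i * infl i j = `|cov i j|.
Proof.
have [d0|dn0] := eqVneq (d i) 0; first by rewrite d0 mul0r cov_d0// normr0.
have dgt0 : 0 < d i by rewrite lt_neqAle eq_sym dn0 d_ge0.
have pgt0 : 0 < p i.
  rewrite lt_neqAle eq_sym p_ge0 andbT.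
  by apply: contraNneq dn0 => p0; rewrite /d p0 mul0r.
have p1gt0 : 0 < 1 - p i.
  rewrite lt_neqAle eq_sym subr_ge0 p_le1 andbT.
  by apply: contraNneq dn0 => p0; rewrite /d p0 mulr0.
(* A coordinate fixed by the conditioning has zero variance. *)
have iL : i \notin L.
  apply: contraTN dgt0 => iL; rewrite -leNgt.
  have ms (t : cfg n) : (t i != s i) -> m t = 0.
    move=> ti; rewrite /m /cond; case: ifP => // /forall_inP/(_ i iL).
    by rewrite eq_sym (negbTE ti).
  have [si|si] := boolP (s i).
    have : marg1 m i false = 0.
      by apply: big1 => t /eqP ti; apply: ms; rewrite ti si.
    by rewrite margF /d => ->; rewrite mulr0.
  have : marg1 m i true = 0.
    by apply: big1 => t /eqP ti; apply: ms; rewrite ti (negbTE si).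
  by rewrite margT /d => ->; rewrite mul0r.
pose c x := marg1 (cond mu (i |: L) (upd s i x)) j.
have csum x : 0 < marg1 m i x -> c x true + c x false = 1.
  move=> mx; rewrite /c marg1_sum cond_sum1//.
  have [t /andP [/eqP ti mt]] : exists t : cfg n, (t i == x) && (0 < m t).
    apply/existsP; apply: contraTT mx => /existsPn H; rewrite -leNgt.
    rewrite /marg1 big1// => t tx; apply/eqP; have := H t.
    by rewrite tx/= lt_neqAle m_ge0 andbT negbK eq_sym.
  exists t; move: mt; rewrite /m /cond; case: ifP => [st mt|]; last by rewrite ltxx.
  rewrite agree_setU1_upd// st ti eqxx; split => //.
  by move: mt; rewrite pmulr_lgt0// invr_gt0 agree_weight_gt0.
have cE x : 0 < marg1 m i x ->
    c x true = (\sum_(t : cfg n | t i == x) m t * (t j)%:R) / marg1 m i x.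
  by move=> _; rewrite /c marg1_cond_setU1.
have cT : c true true = (cov i j + p i * p j) / p i.
  rewrite cE margT//; congr (_ / _); rewrite /cov subrK big_mkcond.
  by apply: eq_bigr => t _; case: (t i); rewrite ?mul1r ?mul0r ?mulr0.
have cF : c false true = (p j - (cov i j + p i * p j)) / (1 - p i).
  rewrite cE margF//; congr (_ / _); rewrite /cov subrK /p -sumrB big_mkcond.
  apply: eq_bigr => t _; case: (t i); rewrite /= ?mul1r ?mul0r ?mulr0 ?subr0//.
  by rewrite subrr.
have dif : c true true - c false true = cov i j / d i.
  by rewrite cT cF /d; field; rewrite !gt_eqF.
have mTF x : 0 < marg1 m i x by case: x; rewrite ?margT ?margF.
have dTVE x y : dTV (c x) (c y) = `|c x true - c y true|.
  by rewrite dTV_bernoulli// !csum.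
have -> : infl i j = `|cov i j| / d i.
  rewrite /infl /influence mxE; apply/eqP; rewrite eq_le; apply/andP; split.
    have X0 : 0 <= `|cov i j| / d i by rewrite divr_ge0.
    apply: bigmax_le => // x _; apply: bigmax_le => // y _.
    rewrite -/(c x) -/(c y) dTVE.
    have E : `|c true true - c false true| = `|cov i j| / d i.
      by rewrite dif normrM normfV (gtr0_norm dgt0).
    by case: x y => [] []; rewrite ?subrr ?normr0// -E// distrC.
  apply: (bigmax_sup true); first exact: mTF.
  apply: (bigmax_sup false); first exact: mTF.
  by rewrite -/(c true) -/(c false) dTVE dif normrM normfV (gtr0_norm dgt0).
by rewrite mulrC divfK.
Qed.

Let infl_d0 i j : d i = 0 -> infl i j = 0.
Proof.
move=> d0; apply/eqP; rewrite eq_le; apply/andP; split; last first.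
  rewrite mxE /=; elim/big_ind: _ => // [x y x0 y0|x _].
    by rewrite le_max x0.
  elim/big_ind: _ => // [a b a0 b0|y _]; first by rewrite le_max a0.
  by rewrite /dTV divr_ge0// sumr_ge0.
rewrite mxE; apply: bigmax_le => // x mx; apply: bigmax_le => // y my.
have -> : x = y.
  move: d0 mx my => /eqP; rewrite mulf_eq0 -/m.
  by case: x y => [] [] //; rewrite margT margF => /orP[] /eqP ->; rewrite ltxx.
by rewrite /dTV big1 ?mul0r// => b _; rewrite subrr normr0.
Qed.

(** Conjugating the influence matrix by the diagonal of standard deviations gives the symmetric
    matrix [|cov i j| / (e i * e j)] with the same eigenvalues, so the Rayleigh bound applies. It
    yields the variances [d i], weakened at the end to the means. *)
Lemma variance_le_spectral_radius (eta : R) (u : 'I_n -> R) :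
  0 <= eta -> spectral_radius infl <= eta ->
  \sum_t m t * (\sum_i u i * (t i)%:R) ^+ 2
    - (\sum_t m t * \sum_i u i * (t i)%:R) ^+ 2
  <= eta * \sum_i u i ^+ 2 * \sum_t m t * (t i)%:R.
Proof.
move=> eta0 SI.
have -> : \sum_t m t * (\sum_i u i * (t i)%:R) ^+ 2
    - (\sum_t m t * \sum_i u i * (t i)%:R) ^+ 2 =
    \sum_i \sum_j u i * u j * cov i j.
  have -> : \sum_t m t * \sum_i u i * (t i)%:R = \sum_i u i * p i.
    under eq_bigr do rewrite mulr_sumr.
    rewrite exchange_big; apply: eq_bigr => i _; rewrite mulr_sumr.
    by apply: eq_bigr => t _; rewrite mulrCA.
  have -> : \sum_t m t * (\sum_i u i * (t i)%:R) ^+ 2 =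
      \sum_i \sum_j u i * u j * \sum_t m t * ((t i)%:R * (t j)%:R).
    under eq_bigr do rewrite expr2 big_distrlr /= mulr_sumr.
    rewrite exchange_big; apply: eq_bigr => i _.
    under eq_bigr do rewrite mulr_sumr.
    rewrite exchange_big; apply: eq_bigr => j _; rewrite mulr_sumr.
    by apply: eq_bigr => t _; ring.
  rewrite expr2 big_distrlr /= -sumrB; apply: eq_bigr => i _.
  by rewrite -sumrB; apply: eq_bigr => j _; rewrite /cov; ring.
(* The value [1] at zero variance keeps the conjugating matrix invertible; the corresponding rows
   and columns vanish anyway. *)
pose e i : R := if d i == 0 then 1 else Num.sqrt (d i).
have e_gt0 i : 0 < e i.
  by rewrite /e; case: eqP => // /eqP d0; rewrite sqrtr_gt0 lt_neqAle eq_sym d0 d_ge0.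
have eN0 i : e i != 0 by rewrite gt_eqF.
pose S : 'M[R]_n := \matrix_(i, j) (`|cov i j| / (e i * e j)).
have Ssym : S^T = S.
  by apply/matrixP => i j; rewrite !mxE covC [e j * _]mulrC.
have ESE : S = diag_mx (\row_i e i) *m infl *m diag_mx (\row_i (e i)^-1).
  apply/matrixP => i j; rewrite mul_mx_diag mul_diag_mx !mxE -/(infl i j).
  have [d0|d0] := eqVneq (d i) 0.
    by have := infl_d0 j d0; rewrite mxE cov_d0// normr0 mul0r => ->; rewrite mulr0 mul0r.
  have := influenceE i j; rewrite mxE => <-.
  have -> : d i = e i * e i by rewrite /e (negbTE d0) -expr2 sqr_sqrtr.
  by field; rewrite !eN0.
have eigS z : eigenvalue (map_mx (fun x : R => (x%:C)%C) S) z -> Normc.normc z <= eta.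
  move=> /eigenvalueP [v vS v0]; apply: le_trans SI.
  apply: eigenvalue_le_spectral_radius; apply/eigenvalueP.
  pose E : 'M[R[i]]_n := map_mx (real_complex R) (diag_mx (\row_i e i)).
  pose F : 'M[R[i]]_n := map_mx (real_complex R) (diag_mx (\row_i (e i)^-1)).
  have FE : F *m E = 1%:M.
    rewrite -map_mxM mulmx_diag; apply/matrixP => i j; rewrite !mxE.
    by case: eqP => // _; rewrite ?mulVf//= rmorph1.
  have EF : E *m F = 1%:M by apply: mulmx1C.
  have SE : map_mx (real_complex R) S = E *m map_mx (real_complex R) infl *m F.
    by rewrite -!map_mxM -ESE.
  exists (v *m E); last first.
    apply: contraNneq v0 => vE; have := congr1 (mulmx^~ F) vE.
    by rewrite -mulmxA EF mulmx1 mul0mx => ->.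
  have := congr1 (mulmx^~ E) vS; rewrite /= -[map_mx _ S]/(map_mx (real_complex R) S) SE.
  by rewrite -!mulmxA FE mulmx1 scalemxAl.
have ray := symmetric_rayleigh_le Ssym eigS.
(* Absolute values match the entries [|cov i j|], so the form at [x] dominates the variance sought;
   the factor [e i] undoes the conjugation. *)
pose x : 'rV[R]_n := \row_i (if d i == 0 then 0 else `|u i| * e i).
have := ray x.
have -> : (x *m S *m x^T) 0 0 = \sum_i \sum_j `|u i| * `|u j| * `|cov i j|.
  rewrite mxE exchange_big; apply: eq_bigr => j _; rewrite !mxE mulr_suml.
  apply: eq_bigr => i _; rewrite !mxE.
  case: eqP => [di|_]; first by rewrite cov_d0// normr0 !(mul0r, mulr0).
  case: eqP => [dj|_]; first by rewrite covC cov_d0// normr0 !(mul0r, mulr0).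
  by field; rewrite !eN0.
have -> : (x *m x^T) 0 0 = \sum_i u i ^+ 2 * d i.
  rewrite mxE; apply: eq_bigr => i _; rewrite !mxE.
  have [->|d0] := eqVneq (d i) 0; first by rewrite /= ?eqxx !mulr0.
  have -> : d i = e i ^+ 2 by rewrite /e (negbTE d0) sqr_sqrtr.
  by rewrite -[u i ^+ 2]real_normK ?num_real//; ring.
move=> H.
apply: le_trans (le_trans _ H) _.
  apply: ler_sum => i _; apply: ler_sum => j _.
  by rewrite -!normrM ler_norm.
rewrite ler_wpM2l// ler_sum// => i _; rewrite ler_wpM2l ?sqr_ge0//.
by rewrite /d ler_piMr// gerBl.
Qed.

End InfluenceVariance.

(** * Logarithmic concavity of the generating polynomial *)

Section Calculus.
Variable R : realType.
Implicit Types (f g : R -> R) (x a b : R).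

Lemma is_derive1_sum (I : Type) (r : seq I) (P : pred I) (F : I -> R -> R)
    (dF : I -> R) x :
  (forall i, P i -> is_derive x 1 (F i) (dF i)) ->
  is_derive x 1 (fun y => \sum_(i <- r | P i) F i y) (\sum_(i <- r | P i) dF i).
Proof.
move=> FdF.
have -> : (fun y => \sum_(i <- r | P i) F i y) = \sum_(i <- r | P i) F i.
  by apply/funext => y; rewrite fct_sumE.
elim/big_ind2: _ => //; first exact: is_derive_cst.
by move=> ? ? ? ?; exact: is_deriveD.
Qed.

Lemma is_derive1_mul f g x a b : is_derive x 1 f a -> is_derive x 1 g b ->
  is_derive x 1 (fun y => f y * g y) (a * g x + f x * b).
Proof.
move=> df dg; rewrite -[fun y => _]/(f * g); apply: is_derive_eq.
by rewrite /GRing.scale /= addrC [g x * a]mulrC.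
Qed.

Lemma is_derive1_cmul c f x a : is_derive x 1 f a ->
  is_derive x 1 (fun y => c * f y) (c * a).
Proof.
move=> df; have := is_derive1_mul (is_derive_cst c x 1) df.
by rewrite mul0r add0r.
Qed.

Lemma is_derive1_expR f x a : is_derive x 1 f a ->
  is_derive x 1 (fun y => expR (f y)) (expR (f x) * a).
Proof. by move=> df; rewrite -[fun y => _]/(expR \o f); exact: is_derive1_comp. Qed.

Lemma is_derive1_lnf f x a : 0 < f x -> is_derive x 1 f a ->
  is_derive x 1 (fun y => ln (f y)) (a / f x).
Proof.
move=> f0 df; rewrite -[fun y => _]/(@ln R \o f) mulrC.
by apply: is_derive1_comp; exact: is_derive1_ln.
Qed.

Lemma is_derive1_div f g x a b : g x != 0 -> is_derive x 1 f a ->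
  is_derive x 1 g b ->
  is_derive x 1 (fun y => f y / g y) ((a * g x - f x * b) / g x ^+ 2).
Proof.
move=> g0 df dg; have dV := is_deriveV g0 dg.
have := is_derive1_mul df dV; congr (is_derive _ _ _ _).
by rewrite /GRing.scale /=; field.
Qed.

Lemma le_of_derive1_le0 f (df : R -> R) x y : x <= y ->
  (forall z, x <= z <= y -> is_derive z 1 f (df z)) ->
  (forall z, x < z < y -> df z <= 0) -> f y <= f x.
Proof.
move=> xy fdf df0.
apply: (@ler0_derive1_le_cc _ f x y); rewrite ?in_itv/= ?lexx ?xy//.
- move=> z; rewrite in_itv/= => /andP[xz zy].
  by apply: (@ex_derive _ _ _ _ _ _ _ (fdf z _)); rewrite !ltW.
- move=> z; rewrite in_itv/= => /andP[xz zy].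
  rewrite derive1E (@derive_val _ _ _ _ _ _ _ (fdf z _)) ?df0 ?xz//.
  by rewrite !ltW.
- apply: derivable_within_continuous => z; rewrite in_itv/= => xzy.
  exact: (@ex_derive _ _ _ _ _ _ _ (fdf z xzy)).
Qed.

End Calculus.

Lemma weighted_sum_gt0 (R : realType) (T : finType) (p h : T -> R) :
  (forall s, 0 <= p s) -> 0 < \sum_s p s -> (forall s, 0 < h s) ->
  0 < \sum_s p s * h s.
Proof.
move=> p0 sp h0; have hn : 0 <= \sum_s p s * h s.
  by rewrite sumr_ge0// => s _; rewrite mulr_ge0// ltW.
rewrite lt_neqAle hn andbT eq_sym; apply/eqP => /psumr_eq0P H.
suff : \sum_s p s = 0 by move/eqP; rewrite gt_eqF.
apply: big1 => s _.
have /eqP := H (fun s _ => mulr_ge0 (p0 s) (ltW (h0 s))) s isT.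
by rewrite mulf_eq0 (gt_eqF (h0 s)) orbF => /eqP.
Qed.

(** * Concavity along segments and the tangent bound for small fields *)

Section GeneratingPolynomial.
Variables (R : realType) (n : nat).
Implicit Types (p w f g : cfg n -> R) (l u z : 'I_n -> R).

Definition field_weight l (s : cfg n) : R := \prod_(i | s i) l i.

Definition genpoly p l : R := \sum_s p s * field_weight l s.

(* [Var_w (sum_i u_i X_i) <= kappa * sum_i u_i^2 E_w X_i], multiplied by the
   square of the total mass of [w] *)
Definition variance_bound (kappa : R) w : Prop := forall u,
  (\sum_s w s * (\sum_i u i * (s i)%:R) ^+ 2) * (\sum_s w s)
    - (\sum_s w s * \sum_i u i * (s i)%:R) ^+ 2
  <= kappa * (\sum_i u i ^+ 2 * \sum_s w s * (s i)%:R) * (\sum_s w s).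

(** On the segment from the all-ones vector to [z] the logarithm of the left side is concave, so it
    lies below its tangent at the all-ones vector. The fields along the segment stay in [(0, b]],
    where the variance bound is available. *)
Lemma genpoly_le_small p (kappa b : R) z :
  (forall s, 0 <= p s) -> \sum_s p s = 1 -> 0 < kappa -> 1 <= b ->
  (forall l, (forall i, 0 < l i <= b) ->
     variance_bound kappa (fun s => p s * field_weight l s)) ->
  (forall i, 0 < z i <= b `^ kappa) ->
  genpoly p (fun i => z i `^ kappa^-1) <=
  expR (kappa^-1 * \sum_i (\sum_s p s * (s i)%:R) * (z i - 1)).
Proof.
move=> p0 p1 k0 b1 VB zb.
(* [h s t] is the logarithm of the weight of [s] under the fields [zs t i] raised to [kappa^-1];
   [h1], [h2] and [F1], [F2] are the first two derivatives of [h] and [F0] in [t]. *)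
pose zs (t : R) i := 1 + t * (z i - 1).
pose h (s : cfg n) (t : R) := kappa^-1 * \sum_(i | s i) ln (zs t i).
pose h1 (s : cfg n) (t : R) := kappa^-1 * \sum_(i | s i) ((z i - 1) / zs t i).
pose h2 (s : cfg n) (t : R) :=
  kappa^-1 * \sum_(i | s i) - ((z i - 1) / zs t i) ^+ 2.
pose F0 t := \sum_s p s * expR (h s t).
pose F1 t := \sum_s p s * (expR (h s t) * h1 s t).
pose F2 t := \sum_s p s * (expR (h s t) * (h1 s t ^+ 2 + h2 s t)).
have zs0 (t : R) (i : 'I_n) : 0 <= t <= 1 -> 0 < zs t i.
  move=> /andP[t0 t1]; have /andP[zi0 _] := zb i.
  have -> : zs t i = (1 - t) + t * z i by rewrite /zs; ring.
  have [->|tn0] := eqVneq t 0; first by rewrite mul0r subr0 addr0 ltr01.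
  by rewrite ltr_wpDl ?subr_ge0// mulr_gt0// lt_neqAle eq_sym tn0.
have zsb (t : R) (i : 'I_n) : 0 <= t <= 1 -> zs t i <= b `^ kappa.
  move=> /andP[t0 t1]; have /andP[_ zi] := zb i.
  have -> : zs t i = (1 - t) * 1 + t * z i by rewrite /zs; ring.
  have -> : b `^ kappa = (1 - t) * b `^ kappa + t * b `^ kappa by ring.
  rewrite lerD// ler_wpM2l// ?subr_ge0//.
  by rewrite -[leLHS](powRr0 b) ler_powR// ltW.
have dzs (t : R) (i : 'I_n) : is_derive t 1 (zs^~ i) (z i - 1).
  have := is_deriveD (is_derive_cst (1 : R) t 1)
    (is_derive1_mul (is_derive_id t 1) (is_derive_cst (z i - 1) t 1)).
  by rewrite mulr0 addr0 mul1r add0r.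
have dh (t : R) (s : cfg n) : 0 <= t <= 1 -> is_derive t 1 (h s) (h1 s t).
  move=> t01; apply: is_derive1_cmul; apply: is_derive1_sum => i _.
  by apply: is_derive1_lnf => //; exact: zs0.
have dh1 (t : R) (s : cfg n) : 0 <= t <= 1 -> is_derive t 1 (h1 s) (h2 s t).
  move=> t01; apply: is_derive1_cmul; apply: is_derive1_sum => i _.
  have := is_derive1_div (g := zs^~ i) (lt0r_neq0 (zs0 t i t01))
    (is_derive_cst (z i - 1) t 1) (dzs t i).
  by congr (is_derive _ _ _ _); rewrite mul0r sub0r exprMn exprVn -expr2 mulNr.
have dF0 (t : R) : 0 <= t <= 1 -> is_derive t 1 F0 (F1 t).
  move=> t01; apply: is_derive1_sum => s _; apply: is_derive1_cmul.
  by apply: is_derive1_expR; exact: dh.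
have dF1 (t : R) : 0 <= t <= 1 -> is_derive t 1 F1 (F2 t).
  move=> t01; apply: is_derive1_sum => s _; apply: is_derive1_cmul.
  have := is_derive1_mul (is_derive1_expR (dh t s t01)) (dh1 t s t01).
  by congr (is_derive _ _ _ _); ring.
have F00 (t : R) : 0 < F0 t.
  by apply: weighted_sum_gt0 => // [|s]; rewrite ?p1 ?ltr01 ?expR_gt0.
(* The sign of the second derivative of [ln F0]. With [u i] the logarithmic derivative of [zs t i],
   this is the variance bound divided by [kappa ^ 2]: [h1 ^ 2] gives the second moment and [h2] the
   term with [kappa]. *)
have concave (t : R) : 0 <= t <= 1 -> F2 t * F0 t - F1 t * F1 t <= 0.
  move=> t01; pose l i := zs t i `^ kappa^-1.
  have lb i : 0 < l i <= b.
    rewrite /l powR_gt0 ?zs0//=.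
    have -> : b = (b `^ kappa) `^ kappa^-1.
      by rewrite -powRrM mulfV ?gt_eqF// powRr1// (le_trans ler01).
    by rewrite ge0_ler_powR ?invr_ge0 ?nnegrE ?powR_ge0 ?zsb// ltW// ?zs0.
  have eh s : expR (h s t) = field_weight l s.
    rewrite /h mulr_sumr expR_sum; apply: eq_bigr => i _.
    by rewrite /l /powR gt_eqF// zs0.
  pose w s := p s * field_weight l s.
  pose u i := (z i - 1) / zs t i.
  have h1E s : h1 s t = kappa^-1 * \sum_i u i * (s i)%:R.
    rewrite /h1 big_mkcond; congr (_ * _); apply: eq_bigr => i _.
    by case: (s i); rewrite ?mulr1 ?mulr0.
  have h2E s : h2 s t = - (kappa^-1 * \sum_i u i ^+ 2 * (s i)%:R).
    rewrite /h2 big_mkcond -mulrN -sumrN; congr (_ * _); apply: eq_bigr => i _.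
    by case: (s i); rewrite ?mulr1 ?mulr0 ?oppr0.
  have F0E : F0 t = \sum_s w s by apply: eq_bigr => s _; rewrite eh.
  have F1E : F1 t = kappa^-1 * \sum_s w s * \sum_i u i * (s i)%:R.
    rewrite mulr_sumr; apply: eq_bigr => s _; rewrite eh h1E /w; ring.
  have F2E : F2 t = kappa^-1 ^+ 2 * (\sum_s w s * (\sum_i u i * (s i)%:R) ^+ 2)
      - kappa^-1 * \sum_i u i ^+ 2 * \sum_s w s * (s i)%:R.
    have -> : \sum_i u i ^+ 2 * (\sum_s w s * (s i)%:R) =
        \sum_s w s * (\sum_i u i ^+ 2 * (s i)%:R).
      under eq_bigr do rewrite mulr_sumr.
      rewrite exchange_big; apply: eq_bigr => s _; rewrite mulr_sumr.
      by apply: eq_bigr => i _; rewrite mulrCA.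
    rewrite !mulr_sumr -sumrB; apply: eq_bigr => s _.
    by rewrite eh h1E h2E /w; ring.
  have := VB l lb u; rewrite -/w F0E F1E F2E.
  set A := \sum_s _ * _ ^+ 2; set B := \sum_s w s; set C := \sum_s _ * \sum_i _.
  set D := \sum_i _ => H.
  have -> : (kappa^-1 ^+ 2 * A - kappa^-1 * D) * B - kappa^-1 * C * (kappa^-1 * C)
      = kappa^-1 ^+ 2 * (A * B - C ^+ 2 - kappa * D * B).
    by field; rewrite gt_eqF.
  by rewrite mulr_ge0_le0 ?sqr_ge0// subr_le0.
have slope (t : R) : 0 <= t <= 1 -> F1 t / F0 t <= F1 0 / F0 0.
  move=> /andP[t0 t1].
  apply: (@le_of_derive1_le0 _ (fun t => F1 t / F0 t)
    (fun t => (F2 t * F0 t - F1 t * F1 t) / F0 t ^+ 2)) => // r /andP[r0 rt].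
    have r01 : 0 <= r <= 1 by rewrite r0 (le_trans rt).
    by apply: is_derive1_div; [rewrite gt_eqF | exact: dF1 | exact: dF0].
  have r01 : 0 <= r <= 1 by rewrite !ltW// (lt_le_trans rt).
  by rewrite mulr_le0_ge0 ?concave// invr_ge0 sqr_ge0.
have zs00 i : zs 0 i = 1 by rewrite /zs mul0r addr0.
have F0_0 : F0 0 = 1.
  rewrite /F0 -[RHS]p1; apply: eq_bigr => s _.
  by rewrite /h big1 ?mulr0 ?expR0 ?mulr1// => i _; rewrite zs00 ln1.
have F1_0 : F1 0 = kappa^-1 * \sum_i (\sum_s p s * (s i)%:R) * (z i - 1).
  have -> : F1 0 = kappa^-1 * \sum_s p s * \sum_i (s i)%:R * (z i - 1).
    rewrite mulr_sumr; apply: eq_bigr => s _.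
    have -> : h s 0 = 0 by rewrite /h big1 ?mulr0// => i _; rewrite zs00 ln1.
    rewrite expR0 mul1r /h1 mulrCA; do 2 congr (_ * _).
    rewrite big_mkcond; apply: eq_bigr => i _; rewrite zs00 divr1.
    by case: (s i); rewrite ?mul1r ?mul0r.
  congr (_ * _); under eq_bigr do rewrite mulr_sumr.
  rewrite exchange_big; apply: eq_bigr => i _; rewrite mulr_suml.
  by apply: eq_bigr => s _; rewrite mulrA.
(* Subtracting the tangent at [0] leaves a function whose derivative [F1 t / F0 t - F1 0] is
   nonpositive, because the slope decreases. *)
have lnF : ln (F0 1) - 1 * F1 0 <= ln (F0 0) - 0 * F1 0.
  apply: (@le_of_derive1_le0 _ (fun t => ln (F0 t) - t * F1 0)
    (fun t => F1 t / F0 t - F1 0)) => // t /andP[t0 t1].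
    have := is_deriveB (is_derive1_lnf (F00 t) (dF0 t _))
      (is_derive1_mul (is_derive_id t 1) (is_derive_cst (F1 0) t 1)).
    by rewrite mulr0 addr0 mul1r; apply; rewrite t0 t1.
  by rewrite subr_le0 -[leRHS]divr1 -F0_0 slope// !ltW.
move: lnF; rewrite F0_0 ln1 mul0r subr0 mul1r subr_le0 F1_0 => lnF.
have -> : genpoly p (fun i => z i `^ kappa^-1) = F0 1.
  apply: eq_bigr => s _; congr (_ * _).
  rewrite /h mulr_sumr expR_sum; apply: eq_bigr => i _.
  have -> : zs 1 i = z i by rewrite /zs mul1r; ring.
  by rewrite /powR gt_eqF//; case/andP: (zb i).
by rewrite -[leLHS]lnK ?posrE// ler_expR.
Qed.

End GeneratingPolynomial.

(** * Entropic independence *)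

Section Flip.
Variable n : nat.
Implicit Types (s : cfg n) (i j : 'I_n).

Definition flip i s : cfg n := upd s i (~~ s i).

Lemma flip_at i s : flip i s i = ~~ s i.
Proof. by rewrite ffunE eqxx. Qed.

Lemma flip_other i j s : j != i -> flip i s j = s j.
Proof. by move=> ji; rewrite ffunE (negbTE ji). Qed.

Lemma flipK i : involutive (flip i).
Proof.
move=> s; apply/ffunP => j; have [->|ji] := eqVneq j i.
  by rewrite !flip_at negbK.
by rewrite !flip_other.
Qed.

End Flip.

Section EntropicIndependence.
Variables (R : realType) (n : nat).
Variables (p : cfg n -> R) (zeta kappa b : R).
Implicit Types (f g : cfg n -> R) (l z : 'I_n -> R).

Let P (i : 'I_n) := \sum_s p s * (s i)%:R.

Hypothesis p_ge0 : forall s, 0 <= p s.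
Hypothesis p_sum : \sum_s p s = 1.
(** Stability with denominators cleared: the odds of [+1] at [i] given all other coordinates are at
    most [zeta] times the unconditional odds. *)
Hypothesis p_stable : forall (s : cfg n) (i : 'I_n), s i ->
  p s * (1 - P i) <= zeta * P i * p (flip i s).
Hypothesis zeta_gt1 : 1 < zeta.

Let P_ge0 i : 0 <= P i.
Proof. by rewrite sumr_ge0// => s _; rewrite mulr_ge0. Qed.

Lemma genpoly_split l i : genpoly p l =
  \sum_(s : cfg n | ~~ s i) p s * \prod_(j | s j && (j != i)) l j +
  l i * \sum_(s : cfg n | s i) p s * \prod_(j | s j && (j != i)) l j.
Proof.
rewrite /genpoly (bigID (fun s : cfg n => s i))/= addrC; congr (_ + _).
  apply: eq_bigr => s si; congr (_ * _); apply: eq_bigl => j.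
  by case: eqVneq => [->|_]; rewrite ?andbT// (negbTE si).
rewrite mulr_sumr; apply: eq_bigr => s si.
by rewrite /field_weight (bigD1 i)//= mulrCA.
Qed.

(** The polynomial is affine in the field at [i], of the form [A + x * B], and its logarithmic slope
    [B / (A + x * B)] is at most [zeta * P i] for [x >= 1]: stability bounds [B * (1 - P i)] by
    [zeta * P i * A], and the remaining [P i * B] is at most [zeta * P i * x * B]. Then
    [1 + y <= exp y] concludes. *)
Lemma genpoly_raise1 l l' i :
  (forall j, 0 <= l' j) -> (forall j, j != i -> l j = l' j) ->
  1 <= l' i -> l' i <= l i ->
  genpoly p l <= genpoly p l' * expR (zeta * P i * (l i - l' i)).
Proof.
move=> l0 ll' l1 li; rewrite (genpoly_split l i) (genpoly_split l' i).
set A := \sum_(s : cfg n | ~~ s i) p s * \prod_(j | _) l' j.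
set B := \sum_(s : cfg n | s i) p s * \prod_(j | _) l' j.
have -> : \sum_(s : cfg n | ~~ s i) p s * \prod_(j | s j && (j != i)) l j = A.
  apply: eq_bigr => s _; congr (_ * _).
  by apply: eq_bigr => j /andP[_ ji]; exact: ll'.
have -> : \sum_(s : cfg n | s i) p s * \prod_(j | s j && (j != i)) l j = B.
  apply: eq_bigr => s _; congr (_ * _).
  by apply: eq_bigr => j /andP[_ ji]; exact: ll'.
have A0 : 0 <= A by rewrite sumr_ge0// => s _; rewrite mulr_ge0// prodr_ge0.
have B0 : 0 <= B by rewrite sumr_ge0// => s _; rewrite mulr_ge0// prodr_ge0.
have BA : B * (1 - P i) <= zeta * P i * A.
  (* Flipping [i] pairs each configuration counted in [B] with one counted in [A] that has the same
     product over the other coordinates. *)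
  rewrite /A (reindex_inj (inv_inj (flipK i)))/=.
  rewrite mulr_suml mulr_sumr big_mkcond [leRHS]big_mkcond; apply: ler_sum => s _.
  rewrite flip_at negbK; case: ifP => // si.
  have -> : \prod_(j | flip i s j && (j != i)) l' j = \prod_(j | s j && (j != i)) l' j.
    by apply: eq_bigl => j; case: eqVneq => [//|ji]; rewrite ?andbF ?flip_other.
  by rewrite mulrAC mulrA ler_wpM2r ?prodr_ge0// p_stable.
have zP0 : 0 <= zeta * P i by rewrite mulr_ge0// ltW// (lt_trans ltr01).
have BAB : B <= zeta * P i * (A + l' i * B).
  have PB : P i * B <= zeta * P i * B.
    by rewrite ler_wpM2r// ler_peMl// ltW.
  have lB : zeta * P i * B <= zeta * P i * (l' i * B).
    by rewrite ler_wpM2l// ler_peMl.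
  by rewrite mulrDr; move: BA PB lB; nra.
have d0 : 0 <= l i - l' i by rewrite subr_ge0.
apply: (@le_trans _ _ ((A + l' i * B) * (1 + zeta * P i * (l i - l' i)))).
  by have := ler_wpM2r d0 BAB; nra.
rewrite ler_wpM2l ?expR_ge1Dx// addr_ge0// mulr_ge0//.
Qed.

(** Coordinates are raised one after another: [lk k] has the new fields on the first [k]
    coordinates, and the exponential costs multiply. *)
Lemma genpoly_raise l l' :
  (forall i, 0 <= l' i) -> (forall i, l i = l' i \/ 1 <= l' i <= l i) ->
  genpoly p l <= genpoly p l' * expR (zeta * \sum_i P i * (l i - l' i)).
Proof.
move=> l0 ll'.
pose lk k (i : 'I_n) := if (i < k)%N then l i else l' i.
have lk0 k i : 0 <= lk k i.
  rewrite /lk; case: ifP => // _; case: (ll' i) => [->//|/andP[h1 h2]].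
  exact: le_trans h2.
suff H k : (k <= n)%N -> genpoly p (lk k) <=
    genpoly p l' * expR (zeta * \sum_(i < n | (i < k)%N) P i * (l i - l' i)).
  have := H n (leqnn n).
  have -> : lk n = l by apply/funext => i; rewrite /lk ltn_ord.
  by under eq_bigl do rewrite ltn_ord.
elim: k => [_|k IH kn].
  by rewrite big_pred0// mulr0 expR0 mulr1.
pose i0 := Ordinal kn.
have -> : \sum_(i < n | (i < k.+1)%N) P i * (l i - l' i) =
    P i0 * (l i0 - l' i0) + \sum_(i < n | (i < k)%N) P i * (l i - l' i).
  rewrite (bigD1 i0)/= ?ltnSn//; congr (_ + _); apply: eq_bigl => i.
  by rewrite ltnS -val_eqE /= [(i < k)%N]ltn_neqAle andbC.
rewrite mulrDr expRD mulrCA mulrC.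
apply: le_trans (ler_wpM2r (expR_ge0 _) (IH (ltnW kn))).
have lkk : lk k i0 = l' i0 by rewrite /lk /= ltnn.
have lkk1 : lk k.+1 i0 = l i0 by rewrite /lk /= ltnSn.
have lko j : j != i0 -> lk k.+1 j = lk k j.
  move=> ji; rewrite /lk ltnS leq_eqVlt.
  by have -> : (nat_of_ord j == k) = false by apply/negbTE; rewrite -val_eqE in ji.
case: (ll' i0) => [e|/andP[h1 h2]].
  rewrite e subrr !mulr0 expR0 mulr1.
  suff -> : lk k.+1 = lk k by [].
  apply/funext => j; have [->|ji] := eqVneq j i0; last exact: lko.
  by rewrite lkk lkk1.
by have := @genpoly_raise1 (lk k.+1) (lk k) i0 (lk0 k) lko; rewrite lkk lkk1 mulrA; apply.
Qed.

(** Bernoulli's inequality for a real exponent, from two tangent bounds of the exponential: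
    [x ^ kappa >= x (1 + (kappa - 1) ln x)] and [x ln x >= x - 1]. *)
Lemma bernoulli_powR (x : R) : 1 <= kappa -> 0 < x ->
  kappa * (x - 1) <= x `^ kappa - 1.
Proof.
move=> k1 x0; rewrite /powR gt_eqF//; set d := ln x.
have xE : x = expR d by rewrite /d lnK.
have e1 : 1 + (kappa - 1) * d <= expR ((kappa - 1) * d) by exact: expR_ge1Dx.
have e2 : 1 - d <= expR (- d) by exact: expR_ge1Dx.
have := ler_wpM2l (ltW x0) e1; have := ler_wpM2l (ltW x0) e2.
have -> : x * expR (- d) = 1 by rewrite xE -expRD subrr expR0.
have -> : x * expR ((kappa - 1) * d) = expR (kappa * d).
  by rewrite {1}xE -expRD; congr expR; ring.
move=> h1 h2; have k0 : 0 <= kappa - 1 by rewrite subr_ge0.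
by have := ler_wpM2l k0 h1; nra.
Qed.

Hypothesis kappa_ge1 : 1 <= kappa.
Hypothesis b_ge1 : 1 <= b.
Hypothesis zeta_b : zeta * b <= b `^ kappa.
Hypothesis p_variance : forall l, (forall i, 0 < l i <= b) ->
  variance_bound kappa (fun s => p s * field_weight l s).

(** The small-field bound handles the truncation [z'] of [z] at [b ^ kappa]. Raising the fields from
    [z'] to [z] costs an amount linear in the [kappa]-th root of [z i], while the right side grows
    linearly in [z i] itself. *)
Lemma genpoly_le z : (forall i, 0 < z i) ->
  genpoly p (fun i => z i `^ kappa^-1) <=
  expR (kappa^-1 * \sum_i P i * (z i - 1)).
Proof.
move=> z0; have k0 : 0 < kappa by apply: lt_le_trans kappa_ge1.
have b0 : 0 < b by apply: lt_le_trans b_ge1.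
pose z' i := Num.min (z i) (b `^ kappa).
have z'b i : 0 < z' i <= b `^ kappa.
  by rewrite /z' lt_min z0 powR_gt0// ge_min lexx orbT.
have bE : (b `^ kappa) `^ kappa^-1 = b.
  by rewrite -powRrM mulfV ?gt_eqF// powRr1// ltW.
have small := genpoly_le_small p_ge0 p_sum k0 b_ge1 p_variance z'b.
have cases i : z i `^ kappa^-1 = z' i `^ kappa^-1 \/
    1 <= z' i `^ kappa^-1 <= z i `^ kappa^-1.
  rewrite /z'; have [zb|zb] := leP (z i) (b `^ kappa); first by left.
  right; rewrite bE b_ge1 -[leLHS]bE ge0_ler_powR ?invr_ge0 ?nnegrE ?powR_ge0 //;
    by rewrite ltW.
apply: (le_trans (genpoly_raise _ cases)) => [i|]; first exact: powR_ge0.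
apply: (le_trans (ler_wpM2r (expR_ge0 _) small)).
rewrite -expRD ler_expR !mulr_sumr -big_split /=; apply: ler_sum => i _.
rewrite -/(P i) [leLHS](_ : _ = P i *
    (kappa^-1 * (z' i - 1) + zeta * (z i `^ kappa^-1 - z' i `^ kappa^-1))); last by ring.
rewrite mulrCA ler_wpM2l//.
rewrite /z'; have [zb|zb] := leP (z i) (b `^ kappa).
  by rewrite subrr mulr0 addr0.
rewrite bE; pose x := z i `^ kappa^-1 / b.
(* Here [z i > b ^ kappa], and [x] is the overshoot of its [kappa]-th root over [b]. The cost
   [zeta * b * (x - 1)] is at most [b ^ kappa * (x - 1)], and Bernoulli bounds [x - 1] by
   [(x ^ kappa - 1) / kappa]. *)
have x0 : 0 < x by rewrite divr_gt0// powR_gt0.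
have lE : z i `^ kappa^-1 = b * x by rewrite /x mulrC divfK// gt_eqF.
have zE : z i = b `^ kappa * x `^ kappa.
  rewrite -powRM ?(ltW b0) ?(ltW x0)// -lE -powRrM mulVf ?gt_eqF// powRr1// ltW//.
have x1 : 1 <= x.
  rewrite /x ler_pdivlMr// mul1r -[leLHS]bE ge0_ler_powR ?invr_ge0 ?nnegrE ?powR_ge0 //;
    by rewrite ltW.
rewrite lE.
have h1 := bernoulli_powR kappa_ge1 x0.
have h2 : zeta * b * (x - 1) <= b `^ kappa * (x - 1).
  by rewrite ler_wpM2r// subr_ge0.
have h3 : x - 1 <= kappa^-1 * (x `^ kappa - 1).
  by rewrite mulrC ler_pdivlMr// mulrC.
have h4 := ler_wpM2l (powR_ge0 b kappa) h3.
rewrite [in leRHS]zE; move: h2 h4; move: (b `^ kappa) (x `^ kappa) => B X h2 h4.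
have -> : zeta * (b * x - b) = zeta * b * (x - 1) by ring.
have -> : kappa^-1 * (B * X - 1) = kappa^-1 * (B - 1) + B * (kappa^-1 * (X - 1)).
  by ring.
by rewrite lerD2l; apply: le_trans h4.
Qed.

(** One half of the variational formula for entropy: apply [ln y <= y - 1] at [y = a g / (f G)], the
    ratio of normalized [g] to normalized [f]. Multiplied by [f], the right side has mean zero. *)
Lemma gibbs_variational f g : (forall s, 0 < f s) -> (forall s, 0 < g s) ->
  \sum_s p s * (f s * ln (g s))
    - (\sum_s p s * f s) * ln (\sum_s p s * g s) <= Ent p f.
Proof.
move=> f0 g0.
have pos h : (forall s, 0 < h s) -> 0 < \sum_s p s * h s.
  by move=> h0; apply: weighted_sum_gt0 => //; rewrite p_sum.
rewrite /Ent; set a := \sum_s p s * f s; set G := \sum_s p s * g s.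
have a0 : 0 < a := pos f f0; have G0 : 0 < G := pos g g0.
suff : \sum_s p s * (f s - a / G * g s) <=
    \sum_s p s * (f s * (ln (f s) - ln a - ln (g s) + ln G)).
  have -> : \sum_s p s * (f s - a / G * g s) = 0.
    under eq_bigr do rewrite mulrBr mulrCA.
    by rewrite sumrB -mulr_sumr -/a -/G divfK ?subrr// gt_eqF.
  have -> : \sum_s p s * (f s * (ln (f s) - ln a - ln (g s) + ln G)) =
      \sum_s p s * (f s * ln (f s)) - a * ln a
      - \sum_s p s * (f s * ln (g s)) + a * ln G.
    rewrite /a !mulr_suml -!sumrB -big_split /=.
    by apply: eq_bigr => s _; ring.
  by rewrite -/a; lra.
apply: ler_sum => s _; rewrite ler_wpM2l//.
have y0 : 0 < (a * g s) / (f s * G) by rewrite divr_gt0 ?mulr_gt0.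
have := @le_ln1Dx _ ((a * g s) / (f s * G) - 1).
rewrite addrCA subrr addr0 ltrBrDl subrr => /(_ y0).
rewrite ln_div ?posrE ?mulr_gt0// !lnM ?posrE// => h.
have := ler_wpM2l (ltW (f0 s)) h.
have -> : f s * (a * g s / (f s * G) - 1) = a / G * g s - f s.
  by field; rewrite !gt_eqF.
by lra.
Qed.

(** Up to the factor [a], the left side sums the divergences [nu_i ln (nu_i / pi_i) - nu_i + pi_i]
    of the one-coordinate marginals. It is tested against the product [prod_i z_i ^ (x_i / kappa)]
    in the variational formula, whose normalization [genpoly_le] controls. *)
Lemma entropic_independence f : (forall s, 0 < f s) ->
  \sum_i ((\sum_s p s * (f s * (s i)%:R)) *
            ln ((\sum_s p s * (f s * (s i)%:R)) / ((\sum_s p s * f s) * P i))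
          - \sum_s p s * (f s * (s i)%:R) + (\sum_s p s * f s) * P i)
  <= kappa * Ent p f.
Proof.
move=> f0; have k0 : 0 < kappa by apply: lt_le_trans kappa_ge1.
set a := \sum_s p s * f s.
pose A (i : 'I_n) := \sum_s p s * (f s * (s i)%:R).
(* The optimal field, the ratio of the probabilities of [+1] at [i] under [f p / a] and under [p].
   If [P i = 0] then [A i = 0] too, and the value [1] only keeps [z] positive. *)
pose z i := if P i == 0 then 1 else A i / (a * P i).
have a0 : 0 < a by apply: weighted_sum_gt0; rewrite ?p_sum.
have A_ge0 i : 0 <= A i.
  by rewrite sumr_ge0// => s _; rewrite !mulr_ge0// ltW.
have AP i : (A i == 0) = (P i == 0).
  rewrite /A /P !psumr_eq0 => [|s _|s _]; last 2 first.
  - by rewrite mulr_ge0.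
  - by rewrite !mulr_ge0// ltW.
  apply: eq_all => s; rewrite /= !mulf_eq0.
  by rewrite (gt_eqF (f0 s)).
have z0 i : 0 < z i.
  rewrite /z; case: ifP => // Pi.
  rewrite divr_gt0 ?mulr_gt0// lt_neqAle eq_sym ?AP Pi//=.
have zP i : a * (P i * (z i - 1)) = A i - a * P i.
  rewrite /z; case: eqP => [Pi|/eqP Pi].
    have /eqP -> : A i == 0 by rewrite AP Pi.
    by rewrite Pi; ring.
  by field; rewrite Pi gt_eqF.
have lnz i : A i * ln (A i / (a * P i)) = A i * ln (z i).
  rewrite /z; case: eqP => // Pi.
  have /eqP -> : A i == 0 by rewrite AP Pi.
  by rewrite !mul0r.
have := gibbs_variational f0 (g := field_weight (fun i => z i `^ kappa^-1)).
have fw_gt0 s : 0 < field_weight (fun i => z i `^ kappa^-1) s.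
  by apply: prodr_gt0 => i _; exact: powR_gt0.
move=> /(_ fw_gt0).
rewrite -/(genpoly p _) -/a.
have -> : \sum_s p s * (f s * ln (field_weight (fun i => z i `^ kappa^-1) s)) =
    kappa^-1 * \sum_i A i * ln (z i).
  have -> : \sum_i A i * ln (z i) =
      \sum_s p s * (f s * \sum_i (s i)%:R * ln (z i)).
    rewrite /A; under eq_bigr do rewrite mulr_suml.
    rewrite exchange_big; apply: eq_bigr => s _; rewrite !mulr_sumr.
    by apply: eq_bigr => i _; ring.
  rewrite mulr_sumr; apply: eq_bigr => s _.
  have -> : ln (field_weight (fun i => z i `^ kappa^-1) s) =
      kappa^-1 * \sum_i (s i)%:R * ln (z i).
    have -> : field_weight (fun i => z i `^ kappa^-1) s =
        expR (\sum_(i | s i) kappa^-1 * ln (z i)).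
      by rewrite expR_sum; apply: eq_bigr => i _; rewrite /powR gt_eqF.
    rewrite expRK mulr_sumr big_mkcond; apply: eq_bigr => i _.
    by case: (s i); rewrite ?mul1r ?mul0r ?mulr0.
  by ring.
have gen_gt0 : 0 < genpoly p (fun i => z i `^ kappa^-1).
  by apply: weighted_sum_gt0 => //; rewrite p_sum.
have lng : ln (genpoly p (fun i => z i `^ kappa^-1)) <=
    kappa^-1 * \sum_i P i * (z i - 1).
  by rewrite -ler_expR lnK ?genpoly_le.
have -> : \sum_i (A i * ln (A i / (a * P i)) - A i + a * P i) =
    \sum_i A i * ln (z i) - a * \sum_i P i * (z i - 1).
  rewrite mulr_sumr -sumrB; apply: eq_bigr => i _; rewrite zP lnz; ring.
move=> gibbs; have := ler_wpM2l (ltW a0) lng => h.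
have {gibbs h} : kappa^-1 * (\sum_i A i * ln (z i) - a * \sum_i P i * (z i - 1))
    <= Ent p f.
  by rewrite mulrBr; move: gibbs h; rewrite mulrCA; lra.
by rewrite ler_pdivrMl.
Qed.

End EntropicIndependence.

(** * Decay of entropy under localization *)

Lemma is_derive1_expn (R : realType) (f : R -> R) (x a : R) k :
  is_derive x 1 f a ->
  is_derive x 1 (fun y => f y ^+ k) (k%:R * f x ^+ k.-1 * a).
Proof.
move=> df; have -> : (fun y => f y ^+ k) = f ^+ k.
  by apply/funext => y; rewrite exprfctE.
exact: is_deriveX.
Qed.

Section Localization.
Variables (R : realType) (n : nat) (mu f : cfg n -> R).
Hypothesis mu_ge0 : forall s, 0 <= mu s.
Hypothesis f_gt0 : forall s, 0 < f s.
Implicit Types (U V : {set 'I_n}) (s : cfg n) (i : 'I_n) (h : cfg n -> R)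
  (th : R).

Definition ones s : {set 'I_n} := [set i | s i].

(** Times [(1 - th) ^ #|U|], this is the joint weight of drawing [s] and then pinning exactly the
    set [U] of its [+1] coordinates. Without normalization it stays polynomial in [th]. *)
Definition pinned_weight th U s : R :=
  if U \subset ones s then mu s * th ^+ #|ones s :\: U| else 0.

Definition pinned_sum h U th : R := \sum_s pinned_weight th U s * h s.

Definition pinned_mass := pinned_sum (fun=> 1).

Definition pinned_lnratio U th : R :=
  ln (pinned_sum f U th / pinned_mass U th).

(** The entropy of [f] under the normalized pinned measure, times the mass before normalization. *)
Definition pinned_ent U th : R :=
  pinned_sum (fun s => f s * ln (f s)) U th
  - pinned_sum f U th * pinned_lnratio U th.

(* average entropy of [f] after each [+1] has been pinned independently with
   probability [1 - th] *)
Definition mean_pinned_ent th : R :=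
  \sum_(U : {set 'I_n}) (1 - th) ^+ #|U| * pinned_ent U th.

(** For [i] outside [U], this is [pinned_mass U th / th] times the divergence
    [nu ln (nu / pi) - nu + pi], where [nu = E (f x_i)] and [pi = E f * E x_i] under the normalized
    pinned measure. *)
Definition pin_loss U i th : R :=
  pinned_sum f (i |: U) th * (pinned_lnratio (i |: U) th - pinned_lnratio U th)
  - pinned_sum f (i |: U) th
  + pinned_sum f U th * pinned_mass (i |: U) th / pinned_mass U th.

Definition pinnable U : bool := [exists s, (U \subset ones s) && (0 < mu s)].

Lemma pinned_weight_ge0 th U s : 0 <= th -> 0 <= pinned_weight th U s.
Proof.
by move=> th0; rewrite /pinned_weight; case: ifP => // _; rewrite mulr_ge0 ?exprn_ge0.
Qed.

Lemma pinned_weight0 th U s : ~~ pinnable U -> pinned_weight th U s = 0.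
Proof.
move=> /existsPn/(_ s); rewrite /pinned_weight; case: ifP => //= _.
by rewrite lt_neqAle mu_ge0 andbT negbK => /eqP <-; rewrite mul0r.
Qed.

Lemma pinned_sum0 h U th : ~~ pinnable U -> pinned_sum h U th = 0.
Proof. by move=> nU; apply: big1 => s _; rewrite pinned_weight0// mul0r. Qed.

Lemma pinned_ent0 U th : ~~ pinnable U -> pinned_ent U th = 0.
Proof. by move=> nU; rewrite /pinned_ent !pinned_sum0// mul0r subrr. Qed.

Lemma pinnableU1 U i : pinnable (i |: U) -> pinnable U.
Proof.
move=> /existsP[s /andP[us ms]]; apply/existsP; exists s; rewrite ms andbT.
exact: fintype.subset_trans (finset.subsetU1 _ _) us.
Qed.

Lemma pinned_mass_gt0 U th : 0 < th -> pinnable U -> 0 < pinned_mass U th.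
Proof.
move=> th0 /existsP[s /andP[us ms]]; rewrite /pinned_mass /pinned_sum (bigD1 s)//=.
rewrite ltr_wpDr//.
  by rewrite sumr_ge0// => t _; rewrite mulr1 pinned_weight_ge0// ltW.
by rewrite /pinned_weight us mulr1 mulr_gt0// exprn_gt0.
Qed.

Lemma pinned_sum_gt0 h U th : (forall s, 0 < h s) -> 0 < th -> pinnable U ->
  0 < pinned_sum h U th.
Proof.
move=> h0 th0 pU; apply: weighted_sum_gt0 => // [s|].
  by rewrite pinned_weight_ge0// ltW.
have := pinned_mass_gt0 th0 pU; rewrite /pinned_mass /pinned_sum.
by under eq_bigr do rewrite mulr1.
Qed.

(** Pinning a further coordinate that is [+1] removes one factor [th]. *)
Lemma pinned_weightU1 th U i s : i \notin U ->
  th * pinned_weight th (i |: U) s = pinned_weight th U s * (s i)%:R.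
Proof.
move=> iU; rewrite /pinned_weight finset.subUset finset.sub1set inE.
case: ifP => [/andP[si us]|]; last first.
  by case: (s i) => /= [->|_]; rewrite ?mulr0 ?mul0r.
rewrite us si mulr1 [in RHS](cardsD1 i) !inE si iU /= add1n exprS mulrCA.
by rewrite finset.setUC -finset.setDDl.
Qed.

Lemma pinned_weight_in th U i s : i \in U ->
  pinned_weight th U s * (s i)%:R = pinned_weight th U s.
Proof.
move=> iU; rewrite /pinned_weight; case: ifP => [us|]; last by rewrite mul0r.
by have := fintype.subsetP us i iU; rewrite inE => ->; rewrite mulr1.
Qed.

(** Differentiating [th ^ k] gives [k] copies of [th ^ (k - 1)], one for each unpinned [+1], and
    each copy is the weight with that coordinate pinned as well. *)
Lemma is_derive_pinned_sum h U th :
  is_derive th 1 (pinned_sum h U) (\sum_(i | i \notin U) pinned_sum h (i |: U) th).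
Proof.
rewrite exchange_big; apply: is_derive1_sum => s _; rewrite -mulr_suml.
have [us|us] := boolP (U \subset ones s); last first.
  have -> : (fun y => pinned_weight y U s * h s) = cst 0.
    by apply/funext => y; rewrite /pinned_weight (negbTE us) mul0r.
  rewrite big1 ?mul0r; first exact: is_derive_cst.
  by move=> i _; rewrite /pinned_weight finset.subUset (negbTE us) andbF.
have -> : (fun y => pinned_weight y U s * h s) =
    (fun y => (h s * mu s) * y ^+ #|ones s :\: U|).
  by apply/funext => y; rewrite /pinned_weight us mulrC mulrA.
have := is_derive1_cmul (h s * mu s)
  (is_derive1_expn #|ones s :\: U| (is_derive_id th 1)).
congr (is_derive _ _ _ _).
have -> : \sum_(i | i \notin U) pinned_weight th (i |: U) s =
    \sum_(i in ones s :\: U) mu s * th ^+ #|ones s :\: U|.-1.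
  rewrite big_mkcond [RHS]big_mkcond; apply: eq_bigr => i _.
  rewrite !inE; case: ifP => //= iU.
  rewrite /pinned_weight finset.subUset finset.sub1set us inE andbT.
  case: ifP => // si; rewrite [in RHS](cardsD1 i (ones s :\: U)) !inE si iU /=.
  by rewrite finset.setUC -finset.setDDl.
by rewrite sumr_const -mulr_natr; ring.
Qed.

(** Each pinned sum differentiates into its versions with one more pin. [pin_loss] collects the
    change of the log-ratio from [U] to [i |: U] and the derivative of the log-ratio itself. *)
Lemma is_derive_pinned_ent U th : 0 < th ->
  is_derive th 1 (pinned_ent U)
    (\sum_(i | i \notin U) (pinned_ent (i |: U) th + pin_loss U i th)).
Proof.
move=> th0; have [pU|nU] := boolP (pinnable U); last first.
  have nUi i : ~~ pinnable (i |: U) by apply: contra nU; exact: pinnableU1.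
  have -> : pinned_ent U = cst 0 by apply/funext => y; rewrite pinned_ent0.
  rewrite big1; first exact: is_derive_cst.
  move=> i _; rewrite pinned_ent0// /pin_loss.
  by rewrite !(pinned_sum0 _ _ nU, pinned_sum0 _ _ (nUi i)) !mul0r subrr !addr0.
have a0 := pinned_sum_gt0 f_gt0 th0 pU.
have b0 := pinned_mass_gt0 th0 pU.
have da := is_derive_pinned_sum f U th.
have db := is_derive_pinned_sum (fun=> 1) U th.
have dc := is_derive_pinned_sum (fun s => f s * ln (f s)) U th.
have dL := is_derive1_lnf (f := fun y => pinned_sum f U y / pinned_mass U y)
  (divr_gt0 a0 b0) (is_derive1_div (g := pinned_mass U) (lt0r_neq0 b0) da db).
have := is_deriveB dc (is_derive1_mul (g := pinned_lnratio U) da dL).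
congr (is_derive _ _ _ _).
have -> : \sum_(i | i \notin U) (pinned_ent (i |: U) th + pin_loss U i th) =
    (\sum_(i | i \notin U) pinned_sum (fun s => f s * ln (f s)) (i |: U) th)
    - (\sum_(i | i \notin U) pinned_sum f (i |: U) th) * pinned_lnratio U th
    - (\sum_(i | i \notin U) pinned_sum f (i |: U) th)
    + pinned_sum f U th * (\sum_(i | i \notin U) pinned_mass (i |: U) th)
      / pinned_mass U th.
  rewrite [_ * pinned_lnratio U th]mulr_suml [pinned_sum f U th * _]mulr_sumr.
  rewrite [_ / pinned_mass U th]mulr_suml -!sumrB -big_split /=.
  by apply: eq_bigr => i _; rewrite /pinned_ent /pin_loss; ring.
rewrite -/pinned_mass; field.
by rewrite !gt_eqF.
Qed.

(** Both sides run over the pairs of a set [V] and an element [i] of it, with [V = i |: U]; the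
    cardinality of [U] is one less. *)
Lemma sum_pin_shift (x : R) (g : {set 'I_n} -> R) :
  \sum_(U : {set 'I_n}) x ^+ #|U| * (\sum_(i | i \notin U) g (i |: U)) =
  \sum_(V : {set 'I_n}) #|V|%:R * x ^+ #|V|.-1 * g V.
Proof.
under eq_bigr do rewrite mulr_sumr.
rewrite (exchange_big_dep xpredT)//=.
have -> : \sum_(V : {set 'I_n}) #|V|%:R * x ^+ #|V|.-1 * g V =
    \sum_(V : {set 'I_n}) \sum_(i in V) x ^+ #|V|.-1 * g V.
  by apply: eq_bigr => V _; rewrite sumr_const -[RHS]mulr_natl mulrA.
rewrite [RHS](exchange_big_dep xpredT)//=; apply: eq_bigr => i _.
rewrite (reindex_onto (fun V => V :\ i) (fun U => i |: U))/=; last first.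
  by move=> U iU; rewrite finset.setU1K.
apply: eq_big => [V|V /andP[_ /eqP VE]].
  rewrite !inE eqxx /=; apply/eqP/idP => [<-|]; first by rewrite setU11.
  exact: finset.setD1K.
rewrite VE; have iV : i \in V by rewrite -VE setU11.
by rewrite [in RHS](cardsD1 i V) iV.
Qed.

(** The terms [pinned_ent (i |: U)], regrouped by the enlarged set, cancel the derivative of the
    factor [(1 - th) ^ #|U|]; only the losses remain. *)
Lemma is_derive_mean_pinned_ent th : 0 < th ->
  is_derive th 1 mean_pinned_ent
    (\sum_(U : {set 'I_n}) (1 - th) ^+ #|U| * \sum_(i | i \notin U) pin_loss U i th).
Proof.
move=> th0.
have d1 : is_derive th 1 (fun y : R => 1 - y) (- 1).
  by have := is_deriveB (is_derive_cst (1 : R) th 1) (is_derive_id th 1); rewrite sub0r.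
have := @is_derive1_sum _ _ (index_enum {set 'I_n}) xpredT
  (fun U y => (1 - y) ^+ #|U| * pinned_ent U y) _ th
  (fun U _ => is_derive1_mul (is_derive1_expn #|U| d1) (is_derive_pinned_ent U th0)).
congr (is_derive _ _ _ _).
rewrite big_split /=; under [X in _ + X]eq_bigr do rewrite big_split mulrDr.
rewrite big_split /= (sum_pin_shift (1 - th) (pinned_ent^~ th)) addrA.
rewrite -big_split /= big1 ?add0r//.
by move=> U _; ring.
Qed.

(** A nonempty [U] carries the factor [0 ^ #|U| = 0], while the empty set keeps [0 ^ 0 = 1]. *)
Lemma mean_pinned_ent1 : \sum_s mu s = 1 -> mean_pinned_ent 1 = Ent mu f.
Proof.
move=> mu1; rewrite /mean_pinned_ent (bigD1 finset.set0)//= big1 => [|U U0]; last first.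
  by rewrite subrr expr0n cards_eq0 (negbTE U0) mul0r.
have w s : pinned_weight 1 finset.set0 s = mu s.
  by rewrite /pinned_weight finset.sub0set expr1n mulr1.
rewrite addr0 cards0 expr0 mul1r /pinned_ent /Ent /pinned_lnratio /pinned_mass.
have sE h : pinned_sum h finset.set0 1 = \sum_s mu s * h s.
  by apply: eq_bigr => s _; rewrite w.
by rewrite !sE; under [X in _ / X]eq_bigr do rewrite mulr1; rewrite mu1 divr1.
Qed.

(** A Gronwall argument: the hypothesis makes [th ^ (- kappa)] times the mean entropy nonincreasing,
    and at [1] it equals [Ent mu f]. *)
Lemma mean_pinned_ent_ge (kappa : R) : \sum_s mu s = 1 ->
  (forall th U, 0 < th < 1 -> pinnable U ->
     th * (\sum_(i | i \notin U) pin_loss U i th) <= kappa * pinned_ent U th) ->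
  forall th, 0 < th < 1 -> th `^ kappa * Ent mu f <= mean_pinned_ent th.
Proof.
move=> mu1 loss th /andP[th0 th1].
pose E' th := \sum_(U : {set 'I_n})
  (1 - th) ^+ #|U| * \sum_(i | i \notin U) pin_loss U i th.
have E'le y : 0 < y < 1 -> y * E' y <= kappa * mean_pinned_ent y.
  move=> /andP[y0 y1]; rewrite !mulr_sumr; apply: ler_sum => U _.
  rewrite mulrCA [leRHS]mulrCA ler_wpM2l ?exprn_ge0 ?subr_ge0 ?(ltW y1)//.
  have [pU|nU] := boolP (pinnable U); first by rewrite loss// y0.
  have nUi i : ~~ pinnable (i |: U) by apply: contra nU; exact: pinnableU1.
  rewrite pinned_ent0// mulr0 big1 ?mulr0// => i _.
  by rewrite /pin_loss !(pinned_sum0 _ _ nU, pinned_sum0 _ _ (nUi i)) !mul0r subrr addr0.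
pose M y := expR (- kappa * ln y) * mean_pinned_ent y.
have : M 1 <= M th.
  apply: (@le_of_derive1_le0 _ M (fun y => expR (- kappa * ln y) * (- kappa * y^-1)
    * mean_pinned_ent y + expR (- kappa * ln y) * E' y)); first exact: ltW.
    move=> y /andP[ty y1]; have y0 := lt_le_trans th0 ty.
    apply: is_derive1_mul; last exact: is_derive_mean_pinned_ent.
    by apply: is_derive1_expR; apply: is_derive1_cmul; exact: is_derive1_ln.
  move=> y /andP[ty y1]; have y0 := lt_trans th0 ty.
  rewrite -mulrA -mulrDr mulr_ge0_le0 ?expR_ge0//.
  have -> : - kappa * y^-1 * mean_pinned_ent y + E' y =
      y^-1 * (y * E' y - kappa * mean_pinned_ent y) by field; rewrite gt_eqF.
  by rewrite mulr_ge0_le0 ?invr_ge0 ?(ltW y0)// subr_le0 E'le// y0.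
rewrite /M ln1 mulr0 expR0 mul1r mean_pinned_ent1// => H.
rewrite /powR gt_eqF//.
apply: (le_trans (ler_wpM2l (expR_ge0 _) H)).
by rewrite mulrA -expRD mulNr subrr expR0 mul1r.
Qed.

Definition pin_distr th U s : R := pinned_weight th U s / pinned_mass U th.

Lemma sum_pin_distr h U th :
  \sum_s pin_distr th U s * h s = pinned_sum h U th / pinned_mass U th.
Proof.
by rewrite mulr_suml; apply: eq_bigr => s _; rewrite /pin_distr mulrAC.
Qed.

Lemma Ent_pin_distr U th :
  Ent (pin_distr th U) f = pinned_ent U th / pinned_mass U th.
Proof.
rewrite /Ent !sum_pin_distr /pinned_ent mulrBl /pinned_lnratio.
by congr (_ - _); rewrite mulrAC.
Qed.

(** Passes from the normalized form of entropic independence to the unnormalized losses; the factor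
    [th] is the one removed by an extra pin. *)
Lemma pin_loss_le (kappa th : R) U : 0 < th -> pinnable U ->
  \sum_i ((\sum_s pin_distr th U s * (f s * (s i)%:R)) *
            ln ((\sum_s pin_distr th U s * (f s * (s i)%:R)) /
                ((\sum_s pin_distr th U s * f s) *
                  \sum_s pin_distr th U s * (s i)%:R))
          - \sum_s pin_distr th U s * (f s * (s i)%:R)
          + (\sum_s pin_distr th U s * f s) * \sum_s pin_distr th U s * (s i)%:R)
  <= kappa * Ent (pin_distr th U) f ->
  th * (\sum_(i | i \notin U) pin_loss U i th) <= kappa * pinned_ent U th.
Proof.
move=> th0 pU.
have a0 := pinned_sum_gt0 f_gt0 th0 pU.
have b0 := pinned_mass_gt0 th0 pU.
have bN0 : pinned_mass U th != 0 by rewrite gt_eqF.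
have sumx h i : i \notin U ->
    pinned_sum (fun s => h s * (s i)%:R) U th = th * pinned_sum h (i |: U) th.
  move=> iU; rewrite mulr_sumr; apply: eq_bigr => s _.
  by rewrite [RHS]mulrA pinned_weightU1// [h s * _]mulrC mulrA.
have sumin h i : i \in U ->
    pinned_sum (fun s => h s * (s i)%:R) U th = pinned_sum h U th.
  move=> iU; apply: eq_bigr => s _.
  by rewrite [h s * _]mulrC mulrA pinned_weight_in.
have sum1x i : pinned_sum (fun s => (s i)%:R) U th =
    pinned_sum (fun s => 1 * (s i)%:R) U th.
  by apply: eq_bigr => s _; rewrite mul1r.
rewrite Ent_pin_distr.
(* A pinned coordinate is [+1] almost surely, so its divergence term vanishes. *)
rewrite (bigID (fun i => i \in U))/= big1 => [|i iU]; last first.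
  rewrite !sum_pin_distr sum1x !sumin// -/pinned_mass divff// mulr1.
  rewrite divff ?ln1 ?mulr0 ?sub0r ?addNr//.
  by rewrite mulf_neq0 ?invr_eq0// gt_eqF.
rewrite add0r mulrA ler_pdivlMr//; apply: le_trans.
rewrite mulr_suml mulr_sumr; apply: ler_sum => i iU.
rewrite !sum_pin_distr sum1x !sumx// -/pinned_mass.
have [pUi|nUi] := boolP (pinnable (i |: U)); last first.
  have e1 : pinned_sum f (i |: U) th = 0 by rewrite pinned_sum0.
  have e2 : pinned_mass (i |: U) th = 0 by rewrite /pinned_mass pinned_sum0.
  by rewrite /pin_loss e1 e2 !(mul0r, mulr0, subr0, addr0).
have ai0 := pinned_sum_gt0 f_gt0 th0 pUi.
have bi0 := pinned_mass_gt0 th0 pUi.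
rewrite /pin_loss /pinned_lnratio.
have -> : th * pinned_sum f (i |: U) th / pinned_mass U th /
    (pinned_sum f U th / pinned_mass U th *
      (th * pinned_mass (i |: U) th / pinned_mass U th)) =
    (pinned_sum f (i |: U) th / pinned_mass (i |: U) th) /
    (pinned_sum f U th / pinned_mass U th).
  by field; rewrite !gt_eqF.
rewrite !ln_div ?posrE ?divr_gt0// le_eqVlt; apply/orP; left; apply/eqP.
by field; rewrite gt_eqF.
Qed.

End Localization.

(** * The Glauber Dirichlet form *)

Section Glauber.
Variables (R : realType) (n : nat).
Implicit Types (mu w f F : cfg n -> R) (s t : cfg n) (i : 'I_n).

Lemma agree_setC1 i s t : agree (~: [set i]) s t = (t == s) || (t == flip i s).
Proof.
apply/forall_inP/orP => [H|[/eqP -> //|/eqP -> j]]; last first.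
  by rewrite !inE => ji; rewrite flip_other.
have tj j : j != i -> t j = s j.
  by move=> ji; have := H j; rewrite !inE ji => /(_ isT)/eqP.
have [ti|ti] := eqVneq (t i) (s i); [left|right]; apply/eqP/ffunP => j.
  by have [->//|ji] := eqVneq j i; rewrite tj.
have [->|ji] := eqVneq j i; last by rewrite tj// flip_other.
by rewrite flip_at; move: ti; case: (t i) (s i) => [] [].
Qed.

Lemma flip_neq i s : flip i s != s.
Proof.
by apply/eqP => /(congr1 (fun t : cfg n => t i)); rewrite flip_at; case: (s i).
Qed.

Lemma sum_agree_setC1 i s F :
  \sum_(t | agree (~: [set i]) s t) F t = F s + F (flip i s).
Proof.
rewrite (bigD1 s) ?agree_setC1 ?eqxx//=; congr (_ + _).
rewrite (big_pred1 (flip i s)) // => t; rewrite agree_setC1 /=.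
by have [->|_] := eqVneq t s; rewrite ?andbT// andbF eq_sym (negbTE (flip_neq i s)).
Qed.

Lemma marg1_cond_setC1 mu i s t : agree (~: [set i]) s t ->
  marg1 (cond mu (~: [set i]) s) i (t i) = mu t / (mu s + mu (flip i s)).
Proof.
move=> st; rewrite -sum_agree_setC1 /marg1 (bigD1 t)//= big1 => [|u /andP[/eqP ui ut]].
  by rewrite addr0 /cond st.
rewrite /cond; case: ifP => // su; case/negP: ut; apply/eqP/ffunP => j.
have [->//|ji] := eqVneq j i.
move/forall_inP: su => /(_ j); move/forall_inP: st => /(_ j).
by rewrite !inE ji => /(_ isT)/eqP <- /(_ isT)/eqP <-.
Qed.

Lemma glauberE mu s t : glauber mu s t = n%:R^-1 * \sum_(i < n)
  (if agree (~: [set i]) s t then mu t / (mu s + mu (flip i s)) else 0).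
Proof.
congr (_ * _); apply: eq_bigr => i _; case: ifP => // st.
exact: marg1_cond_setC1.
Qed.

(** [n] times the flow [w s * P s (flip i s)] of the heat bath along an edge; it is symmetric in the
    endpoints. *)
Definition edge_weight w i s : R := w s * w (flip i s) / (w s + w (flip i s)).

(** The double sum meets each edge from both endpoints, hence the factor [2]. *)
Definition edge_form w f : R := (2 * n%:R)^-1 * \sum_(i < n) \sum_s
  edge_weight w i s *
    ((f s - f (flip i s)) * (ln (f s) - ln (f (flip i s)))).

(** Reversibility: averaging each edge term with its copy under [flip i] produces the product of
    differences. Positivity of [f] keeps every logarithm finite. *)
Lemma dirichletE mu f : (0 < n)%N -> (forall s, 0 <= mu s) ->
  (forall s, 0 < f s) -> dirichlet mu f = (edge_form mu f)%:E.
Proof.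
move=> n0 mu0 f0.
have lnEE s : lnE (f s) = (ln (f s))%:E by rewrite /lnE gt_eqF.
rewrite /dirichlet.
under eq_bigr do rewrite lnEE -EFinM.
under [X in (_ - X)%E]eq_bigr do under eq_bigr do rewrite lnEE -EFinM.
under [X in (_ - X)%E]eq_bigr do rewrite sumEFin.
rewrite !sumEFin -EFinB; congr EFin.
have nN0 : n%:R != 0 :> R by rewrite pnatr_eq0 -lt0n.
pose G i s := edge_weight mu i s * (f s * (ln (f s) - ln (f (flip i s)))).
have step : \sum_s mu s * f s * ln (f s)
    - \sum_s \sum_t mu s * f s * glauber mu s t * ln (f t) =
    n%:R^-1 * \sum_(i < n) \sum_s G i s.
  rewrite -sumrB [in RHS]exchange_big mulr_sumr; apply: eq_bigr => s _.
  have -> : \sum_t mu s * f s * glauber mu s t * ln (f t) =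
      n%:R^-1 * \sum_(i < n) mu s * f s *
        ((mu s * ln (f s) + mu (flip i s) * ln (f (flip i s)))
          / (mu s + mu (flip i s))).
    rewrite mulr_sumr.
    under eq_bigr => t _ do rewrite glauberE mulr_sumr mulr_sumr mulr_suml.
    rewrite exchange_big; apply: eq_bigr => i _.
    rewrite mulrDl -![in RHS](mulrAC _ _^-1).
    rewrite -(sum_agree_setC1 i s (fun t => mu t / (mu s + mu (flip i s)) * ln (f t))).
    rewrite mulrA mulr_sumr [RHS]big_mkcond /=; apply: eq_bigr => t _.
    by case: ifP => _; ring.
  have -> : mu s * f s * ln (f s) =
      n%:R^-1 * \sum_(i < n) mu s * f s * ln (f s).
    rewrite sumr_const card_ord; move: (mu s * f s * ln (f s)) => x.
    by rewrite -[x *+ n]mulr_natl mulKf.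
  rewrite -mulrBr -sumrB /=; congr (_ * _); apply: eq_bigr => i _.
  rewrite /G /edge_weight.
  have [Z0|Z0] := eqVneq (mu s + mu (flip i s)) 0.
    have /eqP := Z0; rewrite paddr_eq0// => /andP[/eqP -> _].
    by rewrite !mul0r subrr.
  by field.
rewrite step /edge_form invfM -mulrA [RHS]mulrCA; congr (_ * _).
rewrite mulr_sumr; apply: eq_bigr => i _.
have sym : \sum_s G i s = \sum_s G i (flip i s).
  exact: reindex_inj (inv_inj (flipK i)).
have -> : \sum_s G i s = 2^-1 * (\sum_s G i s + \sum_s G i (flip i s)).
  by rewrite -sym; field.
congr (_ * _); rewrite -big_split /=; apply: eq_bigr => s _.
by rewrite /G /edge_weight flipK [mu (flip i s) * _]mulrC [mu (flip i s) + _]addrC; ring.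
Qed.

Lemma edge_form_scale w f (c : R) : 0 < c ->
  edge_form (fun s => w s / c) f = edge_form w f / c.
Proof.
move=> c0; rewrite /edge_form -mulrA mulr_suml; congr (_ * _); apply: eq_bigr => i _.
rewrite mulr_suml; apply: eq_bigr => s _; rewrite [RHS]mulrAC; congr (_ * _).
rewrite /edge_weight -mulrDl.
have [Z0|Z0] := eqVneq (w s + w (flip i s)) 0; last by field; rewrite Z0 gt_eqF.
by rewrite Z0 mul0r !invr0 !mulr0 mul0r.
Qed.

Lemma diff_ln_diff_ge0 (x y : R) : 0 < x -> 0 < y ->
  0 <= (x - y) * (ln x - ln y).
Proof.
move=> x0 y0; have [xy|xy] := leP x y.
  by rewrite mulr_le0// subr_le0// ler_ln.
by rewrite mulr_ge0// subr_ge0 ?ltW// ?ltr_ln.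
Qed.

Lemma edge_form_ge0 w f : (forall s, 0 <= w s) -> (forall s, 0 < f s) ->
  0 <= edge_form w f.
Proof.
move=> w0 f0; rewrite mulr_ge0 ?invr_ge0 ?mulr_ge0// sumr_ge0// => i _.
rewrite sumr_ge0// => s _; rewrite mulr_ge0 ?diff_ln_diff_ge0//.
by rewrite /edge_weight divr_ge0 ?mulr_ge0 ?addr_ge0.
Qed.

(* [x y / (x + y)] is the minimum over [t] of [t^2 x + (1 - t)^2 y], hence
   superadditive *)
Lemma parallel_sum_le (x y t : R) : 0 <= x -> 0 <= y ->
  x * y / (x + y) <= t ^+ 2 * x + (1 - t) ^+ 2 * y.
Proof.
move=> x0 y0; have [Z0|Z0] := eqVneq (x + y) 0.
  by rewrite Z0 invr0 mulr0 addr_ge0// mulr_ge0// sqr_ge0.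
rewrite -subr_ge0.
have -> : t ^+ 2 * x + (1 - t) ^+ 2 * y - x * y / (x + y) =
    (t * x - (1 - t) * y) ^+ 2 / (x + y) by field.
by rewrite divr_ge0 ?sqr_ge0 ?addr_ge0.
Qed.

(** The [t] that is optimal for the mixture is used for every component, and the resulting bound is
    linear in the component weights. *)
Lemma edge_weight_superadditive (I : finType) (c : I -> R) (w : I -> cfg n -> R)
    mu i s :
  (forall k, 0 <= c k) -> (forall k s, 0 <= w k s) ->
  (forall s, \sum_k c k * w k s = mu s) ->
  \sum_k c k * edge_weight (w k) i s <= edge_weight mu i s.
Proof.
move=> c0 w0 wmu.
pose t := mu (flip i s) / (mu s + mu (flip i s)).
apply: (@le_trans _ _ (\sum_k c k * (t ^+ 2 * w k s + (1 - t) ^+ 2 * w k (flip i s)))).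
  by apply: ler_sum => k _; rewrite ler_wpM2l// parallel_sum_le.
under eq_bigr do rewrite mulrDr mulrCA [c _ * ((1 - t) ^+ 2 * _)]mulrCA.
rewrite big_split -!mulr_sumr /= !wmu /edge_weight le_eqVlt; apply/orP; left.
have mu0 u : 0 <= mu u by rewrite -wmu sumr_ge0// => k _; rewrite mulr_ge0.
have [Z0|Z0] := eqVneq (mu s + mu (flip i s)) 0.
  have /eqP := Z0; rewrite paddr_eq0// => /andP[/eqP -> /eqP ->].
  by rewrite !(mulr0, mul0r) addr0.
by apply/eqP; rewrite /t; field.
Qed.

Lemma edge_form_superadditive (I : finType) (c : I -> R) (w : I -> cfg n -> R)
    mu f :
  (forall k, 0 <= c k) -> (forall k s, 0 <= w k s) ->
  (forall s, \sum_k c k * w k s = mu s) -> (forall s, 0 < f s) ->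
  \sum_k c k * edge_form (w k) f <= edge_form mu f.
Proof.
move=> c0 w0 wmu f0; rewrite /edge_form.
under eq_bigr do rewrite mulrCA mulr_sumr.
rewrite -mulr_sumr ler_wpM2l ?invr_ge0 ?mulr_ge0//.
rewrite exchange_big; apply: ler_sum => i _.
under eq_bigr do rewrite mulr_sumr.
rewrite exchange_big; apply: ler_sum => s _.
rewrite /=; under eq_bigr => k _ do rewrite [c k * _]mulrA.
by rewrite -mulr_suml ler_wpM2r ?diff_ln_diff_ge0// edge_weight_superadditive.
Qed.

(** Expand a product of factors [(1 - th) + th] at each [+1] and [0 + 1] at each [-1], by the set
    [U] where the first summand is taken. Thus the localization averages back to [mu]. *)
Lemma sum_pinned_weight mu (th : R) s :
  \sum_(U : {set 'I_n}) (1 - th) ^+ #|U| * pinned_weight mu th U s = mu s.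
Proof.
have := bigA_distr (1 : R) (mul := *%R) +%R
  (fun i : 'I_n => if s i then 1 - th else 0) (fun i => if s i then th else 1).
rewrite /= big1 => [|i _]; last by case: (s i); rewrite ?subrK ?add0r.
move=> /esym; rewrite big_mkcond /= => E.
rewrite -[RHS]mulr1 -[in RHS]E mulr_sumr; apply: eq_bigr => U _.
rewrite /pinned_weight; case: ifP => [us|/negbT us]; last first.
  move/subsetPn: us => [i iU]; rewrite inE => si.
  by rewrite mulr0 (bigD1 i)//= iU (negbTE si) mul0r mulr0.
rewrite mulrCA; congr (_ * _).
rewrite (bigID (fun i => i \in U))/=; congr (_ * _).
  rewrite -prodr_const; apply: eq_bigr => i iU; rewrite iU.
  by have := fintype.subsetP us i iU; rewrite inE => ->.
rewrite -prodr_const big_mkcond [RHS]big_mkcond; apply: eq_bigr => i _.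
by rewrite !inE; case: (i \in U) => //=; case: (s i).
Qed.

Lemma Ent_ge0 mu f : (forall s, 0 <= mu s) -> \sum_s mu s = 1 ->
  (forall s, 0 <= f s) -> 0 <= Ent mu f.
Proof.
move=> mu0 mu1 f0; rewrite /Ent; set a := \sum_s mu s * f s.
have an : 0 <= a by rewrite sumr_ge0// => s _; rewrite mulr_ge0.
have [a0|aN0] := eqVneq a 0.
  rewrite a0 mul0r subr0 big1// => s _.
  rewrite mulrA; suff -> : mu s * f s = 0 by rewrite mul0r.
  by apply: (psumr_eq0P _ a0) => // t _; rewrite mulr_ge0.
have a0 : 0 < a by rewrite lt_neqAle eq_sym aN0.
suff : \sum_s mu s * (f s - a) <= \sum_s mu s * (f s * (ln (f s) - ln a)).
  under eq_bigr do rewrite mulrBr.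
  rewrite sumrB -mulr_suml mu1 mul1r -/a subrr.
  under eq_bigr do rewrite mulrBr mulrBr mulrA mulrA.
  rewrite sumrB -mulr_suml -/a.
  by under eq_bigr do rewrite -mulrA.
apply: ler_sum => s _; rewrite ler_wpM2l//.
have [->|fN0] := eqVneq (f s) 0; first by rewrite mul0r sub0r oppr_le0.
have fs0 : 0 < f s by rewrite lt_neqAle eq_sym fN0 f0.
have y0 : 0 < a / f s by rewrite divr_gt0.
have := @le_ln1Dx _ (a / f s - 1).
rewrite addrCA subrr addr0 ltrBrDl subrr => /(_ y0).
rewrite ln_div ?posrE// => h; have := ler_wpM2l (ltW fs0) h.
have -> : f s * (a / f s - 1) = a - f s by field.
by lra.
Qed.

(** The subtracted sum contains [log 0] with a positive coefficient, while the first sum is finite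
    because [0 log 0 = 0]. *)
Lemma dirichlet_eqy mu f s i : (0 < n)%N ->
  (forall s, 0 <= mu s) -> (forall s, 0 <= f s) ->
  0 < mu s -> 0 < f s -> 0 < mu (flip i s) -> f (flip i s) = 0 ->
  dirichlet mu f = +oo%E.
Proof.
move=> n0 mu0 f0 mus fs mui fi.
have g0 u v : 0 <= glauber mu u v.
  rewrite glauberE mulr_ge0 ?invr_ge0// sumr_ge0// => j _; case: ifP => // _.
  by rewrite divr_ge0 ?addr_ge0.
have gs : 0 < glauber mu s (flip i s).
  rewrite glauberE mulr_gt0 ?invr_gt0 ?ltr0n// (bigD1 i)//= ltr_wpDr//.
    by rewrite sumr_ge0// => j _; case: ifP => // _; rewrite divr_ge0 ?addr_ge0.
  by rewrite agree_setC1 eqxx orbT divr_gt0// addr_gt0.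
have fin : (\sum_u (mu u * f u)%:E * lnE (f u) =
    (\sum_u mu u * f u * ln (f u))%:E)%E.
  rewrite -sumEFin; apply: eq_bigr => u _; rewrite /lnE.
  by case: eqP => // ->; rewrite mulr0 mul0e mul0r.
rewrite /dirichlet fin.
suff -> : (\sum_u \sum_v (mu u * f u * glauber mu u v)%:E * lnE (f v) = -oo)%E by [].
apply/esum_eqNyP; exists s; split => //.
apply/esum_eqNyP; exists (flip i s); split => //.
have c0 := mulr_gt0 (mulr_gt0 mus fs) gs.
by rewrite /lnE fi eqxx mulrNy (gtr0_sg c0) mul1e.
Qed.

(** Transitions into points of zero mass have probability zero, so a test function may be made
    positive outside the support. *)
Lemma dirichlet_eq_on_support mu f g : (forall s, 0 <= mu s) ->
  (forall s, 0 < mu s -> f s = g s) -> dirichlet mu f = dirichlet mu g.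
Proof.
move=> mu0 fg.
have mus s : mu s = 0 \/ f s = g s.
  have [->|muN0] := eqVneq (mu s) 0; [by left | right].
  by apply: fg; rewrite lt_neqAle eq_sym muN0 mu0.
rewrite /dirichlet; congr (_ - _)%E.
  by apply: eq_bigr => s _; case: (mus s) => [->|->//]; rewrite !mul0r !mul0e.
apply: eq_bigr => s _; apply: eq_bigr => t _.
case: (mus s) => [->|->]; first by rewrite !mul0r !mul0e.
case: (mus t) => [mut|->//].
suff -> : glauber mu s t = 0 by rewrite !mulr0 !mul0e.
by rewrite glauberE mut big1 ?mulr0// => i _; rewrite mul0r if_same.
Qed.

Lemma Ent_eq_on_support mu f g : (forall s, 0 <= mu s) ->
  (forall s, 0 < mu s -> f s = g s) -> Ent mu f = Ent mu g.
Proof.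
move=> mu0 fg.
have mus (h : R -> R) s : mu s * h (f s) = mu s * h (g s).
  have [->|muN0] := eqVneq (mu s) 0; first by rewrite !mul0r.
  by rewrite fg// lt_neqAle eq_sym muN0 mu0.
rewrite /Ent; under eq_bigr do rewrite (mus (fun x => x * ln x)).
by under [X in X * _]eq_bigr do rewrite (mus id);
  under [X in ln X]eq_bigr do rewrite (mus id).
Qed.

End Glauber.

(** * Pinned tilted measures *)

Section PinnedTilt.
Variables (R : realType) (n : nat) (mu : cfg n -> R).
Hypothesis mu_ge0 : forall s, 0 <= mu s.
Implicit Types (U : {set 'I_n}) (s t : cfg n) (l lam : 'I_n -> R) (th : R).

Definition all_plus : cfg n := [ffun=> true].

Lemma agree_all_plus U t : agree U all_plus t = (U \subset ones t).
Proof.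
apply/forall_inP/fintype.subsetP => H i iU; have := H i iU.
  by rewrite ffunE inE; case: (t i).
by rewrite inE ffunE => ->.
Qed.

Lemma tilt_mass_gt0 lam s : (forall i, 0 < lam i) -> 0 < mu s ->
  0 < \sum_t mu t * \prod_(i | t i) lam i.
Proof.
move=> l0 ms; apply: weighted_sum_gt0 => // [|t]; last exact: prodr_gt0.
by rewrite (bigD1 s)//= ltr_wpDr// sumr_ge0.
Qed.

Lemma tilt_ge0 lam s : (forall i, 0 < lam i) -> 0 <= tilt lam mu s.
Proof.
move=> l0; have P0 t : 0 <= \prod_(i | t i) lam i.
  by apply: prodr_ge0 => i _; exact: ltW.
by rewrite /tilt divr_ge0 ?mulr_ge0// sumr_ge0// => t _; rewrite mulr_ge0.
Qed.

Lemma tilt_gt0 lam s : (forall i, 0 < lam i) ->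
  (0 < tilt lam mu s) = (0 < mu s).
Proof.
move=> l0; have P0 : 0 < \prod_(i | s i) lam i by exact: prodr_gt0.
have [ms|] := ltP 0 (mu s).
  by rewrite /tilt divr_gt0 ?mulr_gt0// (tilt_mass_gt0 l0 ms).
rewrite le_eqVlt ltNge mu_ge0 orbF => /eqP ms.
by rewrite /tilt ms !mul0r ltxx.
Qed.

Lemma in_support_marg_tilt lam U : (forall i, 0 < lam i) -> pinnable mu U ->
  in_support_marg (tilt lam mu) U all_plus.
Proof.
move=> l0 /existsP[s /andP[us ms]]; exists s; split.
  by rewrite /in_support tilt_gt0.
by rewrite agree_all_plus.
Qed.

Lemma pin_distr_ge0 th U s : 0 < th -> pinnable mu U -> 0 <= pin_distr mu th U s.
Proof.
by move=> th0 pU; rewrite divr_ge0 ?pinned_weight_ge0 ?ltW// pinned_mass_gt0.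
Qed.

Lemma pin_distr_sum th U : 0 < th -> pinnable mu U -> \sum_s pin_distr mu th U s = 1.
Proof.
move=> th0 pU; rewrite -mulr_suml.
have -> : \sum_s pinned_weight mu th U s = pinned_mass mu U th.
  by apply: eq_bigr => s _; rewrite mulr1.
by rewrite divff// gt_eqF// pinned_mass_gt0.
Qed.

(** On configurations that are [+1] on [U] the tilt is [th ^ #|U|] times [th] to the number of
    unpinned [+1] times [field_weight l]; the constant disappears in the normalization. *)
Lemma cond_tilt th l U s : 0 < th -> (forall i, 0 < l i) -> pinnable mu U ->
  cond (tilt (fun i => th * l i) mu) U all_plus s =
  pin_distr mu th U s * field_weight l s /
  \sum_t pin_distr mu th U t * field_weight l t.
Proof.
move=> th0 l0 pU; set Z := \sum_t pin_distr mu th U t * _.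
have lam0 i : 0 < th * l i by rewrite mulr_gt0.
pose N := \sum_t mu t * \prod_(i | t i) (th * l i).
have N0 : 0 < N.
  by have /existsP[t /andP[_ mt]] := pU; exact: tilt_mass_gt0 mt.
have b0 := pinned_mass_gt0 mu_ge0 th0 pU.
pose c := th ^+ #|U| * pinned_mass mu U th / N.
have c0 : 0 < c by rewrite divr_gt0 ?mulr_gt0 ?exprn_gt0.
have tE t : agree U all_plus t -> tilt (fun i => th * l i) mu t =
    c * (pin_distr mu th U t * field_weight l t).
  rewrite agree_all_plus => ut; rewrite /tilt -/N big_split /= prodr_const.
  have -> : #|[pred i | t i]| = (#|U| + #|ones t :\: U|)%N.
    have -> : #|[pred i | t i]| = #|ones t| by apply: eq_card => i; rewrite !inE.
    rewrite -(cardsID U (ones t)); congr (_ + _)%N; apply: eq_card => i.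
    rewrite inE; apply/andP/idP => [[]//|iU]; split => //.
    exact: (fintype.subsetP ut).
  rewrite /c /pin_distr /pinned_weight ut exprD /field_weight.
  by field; rewrite !gt_eqF.
have w0 t : ~~ agree U all_plus t -> pin_distr mu th U t * field_weight l t = 0.
  rewrite agree_all_plus => /negbTE ut.
  by rewrite /pin_distr /pinned_weight ut !mul0r.
have sumE : \sum_(t | agree U all_plus t) tilt (fun i => th * l i) mu t = c * Z.
  rewrite /Z mulr_sumr big_mkcond; apply: eq_bigr => t _.
  by case: ifP => [/tE //|/negbT/w0 ->]; rewrite mulr0.
rewrite /cond sumE; case: ifP => [/tE ->|/negbT/w0 ->]; last by rewrite mul0r.
by rewrite -mulf_div divff ?mul1r// gt_eqF.
Qed.

Lemma cond_tilt_const th U s : 0 < th -> pinnable mu U ->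
  cond (tilt (fun=> th) mu) U all_plus s = pin_distr mu th U s.
Proof.
move=> th0 pU; have := cond_tilt s (l := fun=> 1) th0 (fun _ => ltr01) pU.
have -> : (fun i : 'I_n => th * 1) = (fun=> th).
  by apply/funext => i; rewrite mulr1.
have f1 t : field_weight (fun=> 1) t = 1 :> R by apply: big1.
by move=> ->; under eq_bigr do rewrite f1 mulr1; rewrite pin_distr_sum// divr1 f1 mulr1.
Qed.

(** Putting fields [l] on the pinned measure amounts to conditioning the tilt of [mu] by [th * l],
    whose entries stay in [(0, b]] as [th <= 1]. The spectral variance bound is then multiplied by
    the squared mass [S ^ 2]. *)
Lemma pin_distr_variance (eta kappa b th : R) U :
  0 <= eta -> eta <= kappa -> 0 < th <= 1 -> pinnable mu U ->
  (forall lam, (forall i, 0 < lam i <= b) ->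
     spectrally_independent eta (tilt lam mu)) ->
  forall l, (forall i, 0 < l i <= b) ->
  variance_bound kappa (fun s => pin_distr mu th U s * field_weight l s).
Proof.
move=> eta0 ek /andP[th0 th1] pU SI l lb u.
have l0 i : 0 < l i by case/andP: (lb i).
have lam0 i : 0 < th * l i by rewrite mulr_gt0.
pose w s := pin_distr mu th U s * field_weight l s.
pose S := \sum_s w s.
have w0 s : 0 <= w s.
  by rewrite mulr_ge0 ?pin_distr_ge0// prodr_ge0// => i _; exact: ltW.
have S0 : 0 < S.
  apply: weighted_sum_gt0 => [s||s]; rewrite ?pin_distr_ge0 ?pin_distr_sum//.
  exact: prodr_gt0.
have SN0 : S != 0 by rewrite gt_eqF.
have lamb i : 0 < th * l i <= b.
  rewrite lam0 /=; have /andP[_ lib] := lb i; apply: le_trans lib.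
  by rewrite ger_pMl.
have feas := in_support_marg_tilt lam0 pU.
have := variance_le_spectral_radius (fun t => tilt_ge0 t lam0) feas u eta0
  (SI _ lamb U all_plus feas).
have mE s : cond (tilt (fun i => th * l i) mu) U all_plus s = w s / S.
  by rewrite cond_tilt.
have sumE (h : cfg n -> R) :
    \sum_s cond (tilt (fun i => th * l i) mu) U all_plus s * h s =
    (\sum_s w s * h s) / S.
  by rewrite mulr_suml; apply: eq_bigr => s _; rewrite mE mulrAC.
pose A := \sum_s w s * (\sum_i u i * (s i)%:R) ^+ 2.
pose B := \sum_s w s * \sum_i u i * (s i)%:R.
pose C := \sum_i u i ^+ 2 * \sum_s w s * (s i)%:R.
have -> : \sum_i u i ^+ 2 *
    (\sum_s cond (tilt (fun i => th * l i) mu) U all_plus s * (s i)%:R) = C / S.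
  by rewrite mulr_suml; apply: eq_bigr => i _; rewrite sumE mulrA.
rewrite !sumE -/A -/B.
suff : A / S - (B / S) ^+ 2 <= eta * (C / S) -> A * S - B ^+ 2 <= kappa * C * S by [].
have C0 : 0 <= C.
  rewrite sumr_ge0// => i _; rewrite mulr_ge0 ?sqr_ge0// sumr_ge0// => s _.
  by rewrite mulr_ge0.
move=> H; have := ler_wpM2r (sqr_ge0 S) H.
have -> : (A / S - (B / S) ^+ 2) * S ^+ 2 = A * S - B ^+ 2 by field.
have -> : eta * (C / S) * S ^+ 2 = eta * C * S by field.
move/le_trans; apply; rewrite ler_wpM2r ?(ltW S0)// ler_wpM2r//.
Qed.

(** Stability is used with every coordinate but [i] conditioned. The ratio is [+oo] at a zero
    denominator, so its finite bound forces the flipped configuration into the support. *)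
Lemma marginally_stable_flip (zeta : R) (nu : cfg n -> R) s i :
  (forall t, 0 <= nu t) -> marginally_stable zeta nu -> 0 < nu s -> s i ->
  0 < nu (flip i s) /\
  forall U, i \notin U ->
    ((nu s / nu (flip i s))%:E <= zeta%:E * Defs.ratio nu U s i)%E.
Proof.
move=> nu0 stab ns si.
have sL : in_support_marg nu (~: [set i]) s.
  by exists s; split => //; apply/forall_inP.
have iL : i \notin ~: [set i] by rewrite !inE negbK.
have m1 : marg1 (cond nu (~: [set i]) s) i true = nu s / (nu s + nu (flip i s)).
  by rewrite -(marg1_cond_setC1 nu (t := s)) ?si// agree_setC1 eqxx.
have m0 : marg1 (cond nu (~: [set i]) s) i false =
    nu (flip i s) / (nu s + nu (flip i s)).
  by rewrite -(marg1_cond_setC1 nu (t := flip i s)) ?flip_at ?si// agree_setC1 eqxx orbT.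
have Z0 : 0 < nu s + nu (flip i s) by rewrite ltr_wpDr.
have rE : Defs.ratio nu (~: [set i]) s i =
    if nu (flip i s) == 0 then +oo%E else (nu s / nu (flip i s))%:E.
  rewrite /Defs.ratio m1 m0 mulf_eq0 invr_eq0 (gt_eqF Z0) orbF.
  by case: eqP => // /eqP fN0; congr EFin; field; rewrite fN0 gt_eqF.
have fN0 : nu (flip i s) != 0.
  apply/eqP => f0; have [] := stab i finset.set0 (~: [set i]) s (finset.sub0set _) iL sL.
  by rewrite rE f0 eqxx leye_eq.
split; first by rewrite lt_neqAle eq_sym fN0 nu0.
move=> U iU; have [|_] := stab i U (~: [set i]) s _ iL sL.
  by apply/fintype.subsetP => j jU; rewrite !inE; apply: contraNneq iU => <-.
by rewrite rE (negbTE fN0).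
Qed.

(** Clears denominators in the comparison of the odds given all other coordinates with the odds
    given [U]. On configurations that are [+1] on [U], tilt and pinned measure differ by the
    constant factor [T]. *)
Lemma pin_distr_stable (zeta th : R) U s i : 1 < zeta ->
  0 < th -> pinnable mu U -> marginally_stable zeta (tilt (fun=> th) mu) ->
  s i ->
  pin_distr mu th U s * (1 - \sum_t pin_distr mu th U t * (t i)%:R) <=
  zeta * (\sum_t pin_distr mu th U t * (t i)%:R) * pin_distr mu th U (flip i s).
Proof.
move=> zeta1 th0 pU stab si; set P := \sum_t _.
have b0 := pinned_mass_gt0 mu_ge0 th0 pU.
have P0 : 0 <= P by rewrite sumr_ge0// => t _; rewrite mulr_ge0// pin_distr_ge0.
have z0 : 0 < zeta by apply: lt_trans zeta1.
have R0 : 0 <= zeta * P * pin_distr mu th U (flip i s).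
  by rewrite mulr_ge0 ?pin_distr_ge0// mulr_ge0// ltW.
have [us|us] := boolP (U \subset ones s); last first.
  by rewrite {1}/pin_distr /pinned_weight (negbTE us) !mul0r.
have [->|msN0] := eqVneq (pin_distr mu th U s) 0; first by rewrite mul0r.
have ps0 : 0 < pin_distr mu th U s by rewrite lt_neqAle eq_sym msN0 pin_distr_ge0.
have ms : 0 < mu s.
  rewrite lt_neqAle mu_ge0 andbT; apply: contraNneq msN0 => ms.
  by rewrite /pin_distr /pinned_weight us -ms !mul0r.
have [iU|iU] := boolP (i \in U).
  have -> : P = 1.
    rewrite -(pin_distr_sum th0 pU); apply: eq_bigr => t _.
    by rewrite /pin_distr mulrAC pinned_weight_in.
  by rewrite subrr mulr0 mulr1 mulr_ge0 ?(ltW z0) ?pin_distr_ge0.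
have [P1|P1] := eqVneq (1 - P) 0; first by rewrite P1 mulr0.
have lam0 (j : 'I_n) : 0 < th by [].
have ts : 0 < tilt (fun=> th) mu s by rewrite tilt_gt0.
have [tf0 /(_ U iU)] := marginally_stable_flip (fun t => tilt_ge0 t lam0) stab ts si.
have condE t : cond (tilt (fun=> th) mu) U s t = pin_distr mu th U t.
  rewrite -cond_tilt_const// /cond.
  have agE u : agree U s u = agree U all_plus u.
    apply/forall_inP/forall_inP => H j jU; have := H j jU;
      by have := fintype.subsetP us j jU; rewrite inE ffunE => ->.
  by rewrite agE; under eq_bigl do rewrite agE.
have mT : marg1 (cond (tilt (fun=> th) mu) U s) i true = P.
  by rewrite marg1_true; apply: eq_bigr => t _; rewrite condE.
have mF : marg1 (cond (tilt (fun=> th) mu) U s) i false = 1 - P.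
  have := marg1_sum (cond (tilt (fun=> th) mu) U s) i.
  by under [X in _ = X]eq_bigr do rewrite condE; rewrite pin_distr_sum// mT => <-; ring.
have P1_ge0 : 0 <= 1 - P.
  by rewrite -mF marg1_ge0// => t; rewrite condE pin_distr_ge0.
have P1_gt0 : 0 < 1 - P by rewrite lt_neqAle eq_sym P1.
rewrite /Defs.ratio mT mF (negbTE P1) -EFinM lee_fin.
have tE t : U \subset ones t -> tilt (fun=> th) mu t =
    pin_distr mu th U t * \sum_(u | agree U all_plus u) tilt (fun=> th) mu u.
  move=> ut; rewrite -cond_tilt_const// /cond agree_all_plus ut divfK//.
  rewrite gt_eqF//; apply: agree_weight_gt0; first by move=> u; exact: tilt_ge0.
  exact: in_support_marg_tilt.
have uf : U \subset ones (flip i s).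
  apply/fintype.subsetP => j jU; rewrite inE flip_other.
    by have := fintype.subsetP us j jU; rewrite inE.
  by apply: contraNneq iU => <-.
move: tf0 ts; rewrite (tE _ us) (tE _ uf).
set T := \sum_(u | _) _ => tf0 ts.
have T0 : 0 < T by move: ts; rewrite pmulr_rgt0.
have pf0 : 0 < pin_distr mu th U (flip i s) by move: tf0; rewrite pmulr_lgt0.
rewrite -mulf_div divff ?gt_eqF// mulr1 ler_pdivrMr//.
rewrite [zeta * (P / _)]mulrA [_ / (1 - P) * _]mulrAC.
by rewrite ler_pdivlMr.
Qed.

End PinnedTilt.

(** * Comparison of modified log-Sobolev constants *)

Section Main.
Variables (R : realType) (n : nat).
Implicit Types (mu f : cfg n -> R) (s : cfg n).

(** Each support configuration reaches the all-minus one by flipping its [+1] coordinates inside the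
    support, and positivity of [f] crosses every edge in both directions. *)
Lemma positive_on_support mu f s0 :
  (forall s i, 0 < mu s -> s i -> 0 < mu (flip i s)) ->
  (forall s i, 0 < mu s -> 0 < f s -> 0 < mu (flip i s) -> 0 < f (flip i s)) ->
  0 < mu s0 -> 0 < f s0 -> forall s, 0 < mu s -> 0 < f s.
Proof.
move=> down edge.
pose m : cfg n := [ffun=> false].
have toM k s : #|ones s| = k -> 0 < mu s -> (0 < f s) = (0 < f m).
  elim: k s => [|k IH] s ck ms.
    have -> // : s = m.
    apply/ffunP => i; rewrite ffunE; apply/negbTE.
    by have /eqP := ck; rewrite cards_eq0 => /eqP/setP/(_ i); rewrite !inE => ->.
  have [i si] : exists i, i \in ones s.
    by apply/set0Pn; rewrite -card_gt0 ck.
  have mi : 0 < mu (flip i s) by move: si; rewrite inE; exact: down.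
  rewrite -(IH (flip i s))//.
    apply/idP/idP => [fs|fi]; first exact: edge.
    by rewrite -[s](flipK i); apply: edge => //; rewrite flipK.
  move: ck; rewrite (cardsD1 i) si add1n => -[<-]; apply: eq_card => j.
  rewrite !inE; have [->|ji] := eqVneq j i; last by rewrite flip_other.
  by rewrite flip_at; move: si; rewrite inE => ->.
move=> m0 f0 s ms; rewrite (toM _ _ erefl ms).
by rewrite -(toM _ _ erefl m0).
Qed.

Variables (mu : cfg n -> R) (eta eps zeta kappa : R).
Hypothesis eta_gt1 : 1 < eta.
Hypothesis eps_gt0 : 0 < eps.
Hypothesis zeta_gt1 : 1 < zeta.
Hypothesis mu_distr : is_distr mu.
Hypothesis SI : forall lam : 'I_n -> R, (forall i, 0 < lam i <= 1 + eps) ->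
  spectrally_independent eta (tilt lam mu).
Hypothesis MS : forall lam : 'I_n -> R, (forall i, 0 < lam i <= 1) ->
  marginally_stable zeta (tilt lam mu).
Hypothesis eta_le_kappa : eta <= kappa.
Hypothesis zeta_le : zeta * (1 + eps) <= (1 + eps) `^ kappa.

Let mu_ge0 s : 0 <= mu s. Proof. by case: mu_distr. Qed.
Let mu_sum : \sum_s mu s = 1. Proof. by case: mu_distr. Qed.

Lemma localized_entropy_decay f th : (forall s, 0 < f s) -> 0 < th < 1 ->
  th `^ kappa * Ent mu f <= mean_pinned_ent mu f th.
Proof.
move=> f0; apply: mean_pinned_ent_ge => // y U /andP[y0 y1] pU.
apply: pin_loss_le => //.
apply: (@entropic_independence _ _ (pin_distr mu y U) zeta kappa (1 + eps)) => //.
- by move=> s; exact: pin_distr_ge0.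
- exact: pin_distr_sum.
- move=> s i si; apply: pin_distr_stable => //; apply: MS => _.
  by rewrite y0 ltW.
- by rewrite (le_trans (ltW eta_gt1)).
- by rewrite lerDl ltW.
- apply: (@pin_distr_variance _ _ mu mu_ge0 eta) => //.
  + by rewrite (le_trans ler01)// ltW.
  + by rewrite y0 ltW.
Qed.

(** The form of [mu] dominates the mean form of the pinned measures, each of these dominates [r]
    times its entropy, and the mean entropy is at least [th ^ kappa] times the initial one. *)
Lemma edge_form_ge_Ent f th (r : R) : (0 < n)%N -> (forall s, 0 < f s) ->
  0 < th < 1 -> 0 <= r -> (r%:E <= rhoGD_min (tilt (fun=> th) mu))%E ->
  th `^ kappa * r * Ent mu f <= edge_form mu f.
Proof.
move=> n0 f0 th01 r0 rmin; have /andP[th0 th1] := th01.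
have loc U : pinnable mu U ->
    r * pinned_ent mu f U th <= edge_form (pinned_weight mu th U) f.
  move=> pU; have b0 := pinned_mass_gt0 mu_ge0 th0 pU.
  have p0 s := pin_distr_ge0 mu_ge0 s th0 pU.
  have p1 := pin_distr_sum mu_ge0 th0 pU.
  suff : r * Ent (pin_distr mu th U) f <= edge_form (pin_distr mu th U) f.
    by rewrite Ent_pin_distr edge_form_scale// mulrA ler_pM2r ?invr_gt0.
  (* With zero entropy [f] is not admissible in the infimum; nonnegativity of the form suffices
     then. *)
  have [->|EN0] := eqVneq (Ent (pin_distr mu th U) f) 0.
    by rewrite mulr0 edge_form_ge0.
  have E0 : 0 < Ent (pin_distr mu th U) f.
    by rewrite lt_neqAle eq_sym EN0 Ent_ge0// => s; exact: ltW.
  have condE : cond (tilt (fun=> th) mu) U (all_plus n) = pin_distr mu th U.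
    by apply/funext => s; rewrite cond_tilt_const.
  have : (r%:E <= dirichlet (pin_distr mu th U) f / (Ent (pin_distr mu th U) f)%:E)%E.
    apply: (le_trans rmin); apply: ge_ereal_inf.
    exists (rhoGD (pin_distr mu th U)).
      exists (U, all_plus n) => /=; last by rewrite condE.
      exact: in_support_marg_tilt.
    apply: ereal_inf_lbound; exists f => //; split => // s; exact: ltW.
  rewrite dirichletE// inver (negbTE EN0) -EFinM lee_fin.
  by rewrite ler_pdivlMr.
have := edge_form_superadditive
  (c := fun U : {set 'I_n} => (1 - th) ^+ #|U|) (w := pinned_weight mu th)
  (mu := mu) (f := f) _ _ (sum_pinned_weight mu th) f0.
move=> H; apply: le_trans (H _ _); last 2 first.
- by move=> U; rewrite exprn_ge0// subr_ge0 ltW.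
- by move=> U s; rewrite pinned_weight_ge0// ltW.
rewrite mulrAC mulrC.
apply: (le_trans (ler_wpM2l r0 (localized_entropy_decay f0 th01))).
rewrite mulr_sumr; apply: ler_sum => U _.
rewrite mulrCA ler_wpM2l ?exprn_ge0 ?subr_ge0 ?(ltW th1)//.
have [pU|nU] := boolP (pinnable mu U); first exact: loc.
rewrite pinned_ent0// mulr0 edge_form_ge0// => s.
by rewrite pinned_weight_ge0// ltW.
Qed.

(** Test functions may have zeros. If one drops to zero along an edge of the support, its Dirichlet
    form is infinite; otherwise it is positive on the whole support and may be set to [1] outside,
    where [edge_form_ge_Ent] applies. *)
Lemma rhoGD_ge th (c : R) : 0 < th < 1 -> 0 < c <= th `^ kappa ->
  (c%:E * rhoGD_min (tilt (fun=> th) mu) <= rhoGD mu)%E.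
Proof.
move=> th01 /andP[c0 cth]; apply: le_ereal_inf_tmp => _ [f [f0 EN0] <-].
have E0 : 0 < Ent mu f by rewrite lt_neqAle eq_sym EN0 Ent_ge0.
(* For [n = 0] there is a single configuration and every entropy is zero. *)
have n0 : (0 < n)%N.
  rewrite lt0n; apply: contraNneq EN0 => n0; apply/eqP.
  have all1 (h : cfg n -> R) : \sum_s h s = h (all_plus n).
    rewrite (big_pred1 (all_plus n)) // => s; apply/esym/eqP/ffunP => i.
    by exfalso; have := leq_ltn_trans (leq0n i) (ltn_ord i); rewrite n0.
  have m1 : mu (all_plus n) = 1 by rewrite -(all1 mu).
  by rewrite /Ent !all1 m1 !mul1r subrr.
have one01 : forall i : 'I_n, 0 < (1 : R) <= 1 by move=> _; rewrite ltr01 lexx.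
have down s i : 0 < mu s -> s i -> 0 < mu (flip i s).
  move=> ms si; have t0 (j : 'I_n) : 0 < (1 : R) by rewrite ltr01.
  have ts : 0 < tilt (fun=> 1) mu s by rewrite tilt_gt0.
  have [] := marginally_stable_flip (fun t => tilt_ge0 mu_ge0 t t0) (MS one01) ts si.
  by rewrite tilt_gt0.
have invE : ((Ent mu f)%:E^-1 = (Ent mu f)^-1%:E)%E by rewrite inver (negbTE EN0).
have [/existsP[s /existsP[i /and4P[ms fs mi /eqP fi]]]|noedge] :=
  boolP [exists s : cfg n, [exists i : 'I_n, [&& 0 < mu s, 0 < f s,
    0 < mu (flip i s) & f (flip i s) == 0]]].
  rewrite (dirichlet_eqy n0 mu_ge0 f0 ms fs mi fi) invE gt0_mulye ?leey//.
  by rewrite lte_fin invr_gt0.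
have edge s i : 0 < mu s -> 0 < f s -> 0 < mu (flip i s) -> 0 < f (flip i s).
  move=> ms fs mi; rewrite lt_neqAle f0 andbT eq_sym; apply: contraNN noedge => fi.
  by apply/existsP; exists s; apply/existsP; exists i; rewrite ms fs mi fi.
have [s0 /andP[ms0 fs0]] : exists s, (0 < mu s) && (0 < f s).
  apply/existsP; apply: contraNT EN0 => /existsPn H.
  rewrite (Ent_eq_on_support (g := fun=> 0)) => [|//|s ms]; last first.
    by have := H s; rewrite ms /= lt_neqAle f0 andbT negbK => /eqP.
  rewrite /Ent [X in _ - X * _]big1 => [|s _]; last by rewrite mulr0.
  by rewrite big1 => [|s _]; rewrite mul0r ?subrr ?mulr0.
pose g s := if 0 < mu s then f s else 1.
have fg s : 0 < mu s -> f s = g s by rewrite /g => ->.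
have g0 s : 0 < g s.
  by rewrite /g; case: ifP => // ms; exact: (positive_on_support down edge ms0 fs0).
rewrite invE (dirichlet_eq_on_support mu_ge0 fg) dirichletE//.
rewrite (Ent_eq_on_support mu_ge0 fg) in E0 *.
have D0 := edge_form_ge0 mu_ge0 g0.
have key (r : R) : 0 <= r -> (r%:E <= rhoGD_min (tilt (fun=> th) mu))%E ->
    c * r * Ent mu g <= edge_form mu g.
  move=> r0 rmin; apply: le_trans (edge_form_ge_Ent n0 g0 th01 r0 rmin).
  by rewrite ler_wpM2r ?(ltW E0)// ler_wpM2r.
rewrite -EFinM.
case: (rhoGD_min _) key => [r||] key.
- rewrite -EFinM lee_fin ler_pdivlMr//; have [r0|r0] := leP 0 r; first exact: key.
  apply: le_trans D0; rewrite mulr_le0_ge0 ?(ltW E0)//.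
  by rewrite mulr_ge0_le0// ltW.
(* An infinite constant would admit every [r]; this one turns [key] into
   [edge_form mu g + 1 <= edge_form mu g]. *)
- have r0 : 0 <= (edge_form mu g + 1) / (c * Ent mu g).
    by apply: divr_ge0; [exact: addr_ge0 | exact/ltW/mulr_gt0].
  have := key _ r0 (leey _).
  have -> : c * ((edge_form mu g + 1) / (c * Ent mu g)) * Ent mu g = edge_form mu g + 1.
    by field; rewrite !gt_eqF.
  by rewrite gerDl ler10.
- by rewrite mulrNy gtr0_sg// mul1e leNye.
Qed.

End Main.

Theorem theorem1p11 (R : realType) (n : nat) (eta eps zeta : R)
  (mu : cfg n -> R) :
  1 < eta -> 0 < eps -> 1 < zeta ->
  is_distr mu ->
  (forall lam : 'I_n -> R, (forall i, 0 < lam i <= 1 + eps) ->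
     spectrally_independent eta (tilt lam mu)) ->
  (forall lam : 'I_n -> R, (forall i, 0 < lam i <= 1) ->
     marginally_stable zeta (tilt lam mu)) ->
  forall theta : R, 0 < theta < 1 ->
    (((theta / expR 1) `^ (30 * eta + ln (4 * zeta) / ln (1 + eps)))%:E
       * rhoGD_min (tilt (fun _ => theta) mu) <= rhoGD mu)%E.
Proof.
move=> eta1 eps0 zeta1 mud SI MS th th01; have /andP[th0 th1] := th01.
have b1 : 1 < 1 + eps by rewrite ltrDl.
have b0 : 0 < 1 + eps by apply: lt_trans b1.
have lnb : 0 < ln (1 + eps) by rewrite ln_gt0.
have z0 : 0 < zeta by apply: lt_trans zeta1.
have ln4z : ln zeta <= ln (4 * zeta) by rewrite ler_ln ?posrE ?mulr_gt0//; lra.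
have lnz : 0 < ln zeta by rewrite ln_gt0.
have q0 : 0 <= ln (4 * zeta) / ln (1 + eps).
  by rewrite divr_ge0 ?(ltW lnb)// (le_trans (ltW lnz)).
set kappa := 30 * eta + _.
have kE : kappa * ln (1 + eps) = 30 * eta * ln (1 + eps) + ln (4 * zeta).
  by rewrite /kappa mulrDl divfK// gt_eqF.
apply: (rhoGD_ge (eta := eta) (eps := eps) (zeta := zeta) (kappa := kappa)) => //.
- by rewrite /kappa; lra.
(* In logarithms: [ln zeta <= ln (4 * zeta)], and [30 * eta >= 1] pays for [ln (1 + eps)]. *)
- rewrite /powR gt_eqF// kE -[zeta * _]lnK ?posrE ?mulr_gt0// ler_expR lnM ?posrE//.
  nra.
(* The localization gives the base [th]; as [th / e <= th] and [kappa >= 0], the stated factor is at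
   most [th ^ kappa]. *)
- rewrite powR_gt0 ?divr_gt0 ?expR_gt0//=.
  rewrite ge0_ler_powR ?nnegrE ?divr_ge0 ?expR_ge0 ?(ltW th0)//.
    by rewrite /kappa; lra.
  rewrite ler_pdivrMr ?expR_gt0// ler_peMr ?(ltW th0)//.
  by rewrite -[leLHS]expR0 ler_expR ler01.
Qed.
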